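(* Let $u\geq 1$ and let $\ell_1,\ldots,\ell_u\geq 3$ be integers (not necessarily distinct), and let $L=\{\ell_1,\ldots,\ell_u\}$ (as a multiset). Set $b=\sum_{i=1}^u \ell_i$, $b_0 = 2|L_0|\,(\max(L_0)+3)$ and $b_1 = 7^{|L_1|-1}(2\max(L_1)+1)$. Then $OP(y,\ell_1,\ldots,\ell_u)$ has a solution for every integer $y$ with \[ y \geq 3b + 24 b_0 + 28 b_1 + 119 . \]
   Context: For an integer $v\geq 3$, $K_v^*$ denotes the complete graph $K_v$ if $v$ is odd, and $K_v$ minus the edges of a $1$-factor (perfect matching) if $v$ is even. For a $2$-regular graph $F$ of order $v$, the Oberwolfach problem $OP(F)$ asks for a decomposition of the edge set of $K_v^*$ into spanning subgraphs each isomorphic to $F$ (a $2$-factorization of $K_v^*$ into copies of $F$); such a decomposition is called a solution to $OP(F)$. For integers $m_1,\ldots,m_s\geq 3$, $OP(m_1,\ldots,m_s)$ denotes $OP(F)$ where $F$ is a $2$-regular graph whose cycles have lengths exactly $m_1,\ldots,m_s$ (so its order is $\sum m_j$). For a multiset $L$ of positive integers, $L_0$ and $L_1$ denote the sub-multisets of even and odd elements respectively, $|L|$ denotes size counted with multiplicity, and by convention $\max(\varnothing)=0$. *)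

(* Defs.v *)
From mathcomp Require Import all_boot.
Set Implicit Arguments. Unset Strict Implicit. Unset Printing Implicit Defensive.

(* Graphs on the vertex set 'I_v; an edge is a 2-element subset of 'I_v,
   a (spanning) graph is given by its edge set. *)

Definition complete_edges (v : nat) : {set {set 'I_v}} :=
  [set e : {set 'I_v} | #|e| == 2].

Definition perfect_matching (v : nat) (M : {set {set 'I_v}}) : Prop :=
  M \subset complete_edges v /\
  forall x : 'I_v, #|[set e in M | x \in e]| = 1.

Definition Kstar_edges (v : nat) (E : {set {set 'I_v}}) : Prop :=
  if odd v then E = complete_edges v
  else exists M, perfect_matching M /\ E = complete_edges v :\: M.

Definition cycle_edges (v : nat) (c : seq 'I_v) : {set {set 'I_v}} :=
  [set [set x; next c x] | x in c].

Definition two_factor_of_type (v : nat) (ms : seq nat) (G : {set {set 'I_v}}) : Prop :=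
  exists cs : seq (seq 'I_v),
    [/\ map size cs = ms,
        uniq (flatten cs),
        size (flatten cs) = v &
        G = \bigcup_(c <- cs) cycle_edges c].

Definition OP_solvable (ms : seq nat) : Prop :=
  exists (E : {set {set 'I_(sumn ms)}}) (Fs : seq {set {set 'I_(sumn ms)}}),
    [/\ Kstar_edges E,
        (forall F, F \in Fs -> two_factor_of_type ms F),
        (forall i j, i < size Fs -> j < size Fs -> i != j ->
            [disjoint nth set0 Fs i & nth set0 Fs j]) &
        E = \bigcup_(F <- Fs) F].

(* Main.v *)
Require Import Defs.
From mathcomp Require Import all_boot zify.
Set Implicit Arguments. Unset Strict Implicit. Unset Printing Implicit Defensive.

(** Write [v = 2N + 1 + mu] with [mu] in [{0, 1}], so that [N] two-factors are needed. Inside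
    [Z_N], cycles of lengths [ls] with pairwise distinct differences are chosen greedily in
    the upper half of [0 .. N-1]; the remaining differences, taken in decreasing order, are
    realised by one zigzag path in the lower half, whose end is joined to an extra vertex.
    The [N] translates of this graph decompose [K_(N+1)] into copies of the cycles plus
    linear forests. The other vertices are then added one at a time, as in Hilton's
    embedding theorem: with [t] vertices missing, each colour has exactly [t] paths
    (possibly empty), and the new vertex merges two paths of each colour. Which ends are
    used is decided by Rado's theorem on independent transversals, the fractional solution
    giving weight [1/t] to every end. The last vertex closes the remaining path of each
    colour into the long cycle. *)

(** * Edges of paths and cycles *)

(** The starting order [N + 1] comes from the case [mu = 1]. No edge of the one-factor is placed
    among the starting vertices, and every later vertex is matched with a starting one. So there
    must be as many missing vertices as present ones, out of [2 * N + 2].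

    An even [N] raises a second difficulty: the difference [N / 2] yields only [N / 2] edges, so
    half of the colours must do without it. The zigzag therefore begins with this largest
    difference. Dropping its first edge only cuts off one vertex and leaves a linear forest.

    The embedding never touches the short cycles and keeps only an upper bound of one on edge
    multiplicities. Exactness is recovered at the end by counting degrees.

    Each vertex of a short cycle costs the greedy choice at most five places in a window of length
    about [N / 2], which is about [(y + b) / 4]. Hence [y >= 20 * b + 20] is enough, and the stated
    bound dominates this one. *)

Section EdgeLists.
Variable T : eqType.
Implicit Types (p c s : seq T) (l : seq (T * T)).

Definition path_edges p := if p is x :: s then pairmap pair x s else [::].
Definition closed_edges c := if c is x :: s then pairmap pair x (rcons s x) else [::].
(** Lists of ordered pairs replace edge sets so that multiplicities add up over pieces and colours.
    Both orientations count, so a loop counts twice. *)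
Definition mult x y l := count_mem (x, y) l + count_mem (y, x) l.
Definition degree x l := count (fun e => e.1 == x) l + count (fun e => e.2 == x) l.
(** A one-vertex path has two ends at its vertex and an empty path has none. With this convention
    degree plus ends is 2 at each vertex of a simple path. *)
Definition ends x p : nat := (ohead p == Some x) + (ohead (rev p) == Some x).

Lemma mult_sym x y l : mult x y l = mult y x l.
Proof. exact: addnC. Qed.

Lemma mult_cat x y l l' : mult x y (l ++ l') = mult x y l + mult x y l'.
Proof. by rewrite /mult !count_cat; lia. Qed.

Lemma mult_cons x y e l : mult x y (e :: l) = mult x y [:: e] + mult x y l.
Proof. by rewrite -cat1s mult_cat. Qed.

Lemma mult_sum x y l : mult x y l = \sum_(e <- l) mult x y [:: e].
Proof.
elim: l => [|e l IHl]; first by rewrite big_nil.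
by rewrite big_cons mult_cons IHl.
Qed.

Lemma mult1E x y a b :
  mult x y [:: (a, b)] = (a == x) && (b == y) + (a == y) && (b == x).
Proof. by rewrite /mult /= !xpair_eqE !addn0. Qed.

Lemma path_edges_cons z p :
  path_edges (z :: p) = if p is w :: _ then (z, w) :: path_edges p else [::].
Proof. by case: p. Qed.

Lemma mult_path_cons x y z p :
  mult x y (path_edges (z :: p)) = mult x y (path_edges p)
    + (z == y) && (ohead p == Some x) + (z == x) && (ohead p == Some y).
Proof.
rewrite path_edges_cons; case: p => [|w p] /=; first by rewrite !andbF.
by rewrite mult_cons mult1E !(inj_eq Some_inj); lia.
Qed.

Lemma path_edges_cat p z s :
  path_edges (p ++ z :: s) = path_edges (rcons p z) ++ path_edges (z :: s).
Proof. by case: p => [|x p] //=; rewrite -cat_rcons pairmap_cat last_rcons. Qed.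

Lemma mult_path_rev x y p : mult x y (path_edges (rev p)) = mult x y (path_edges p).
Proof.
elim: p => [//|a [//|b p] IHp].
rewrite mult_path_cons -IHp 2!rev_cons -!cats1 -catA /= path_edges_cat mult_cat cats1.
by rewrite -addnA; congr (_ + _); rewrite mult1E /= !(inj_eq Some_inj) andbC [(b == y) && _]andbC.
Qed.

Lemma mult_path_rcons x y z p :
  mult x y (path_edges (rcons p z)) = mult x y (path_edges p)
    + (z == y) && (ohead (rev p) == Some x) + (z == x) && (ohead (rev p) == Some y).
Proof.
by rewrite -mult_path_rev rev_rcons mult_path_cons mult_path_rev.
Qed.

(** The reversal puts the head of [p] next to [z], so [z] is joined to both heads; an empty piece
    contributes no edge. *)
Lemma mult_path_join x y z p s :
  mult x y (path_edges (rev p ++ z :: s)) =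
    mult x y (path_edges p) + mult x y (path_edges s)
    + (z == y) * ((ohead p == Some x) + (ohead s == Some x))
    + (z == x) * ((ohead p == Some y) + (ohead s == Some y)).
Proof.
rewrite path_edges_cat mult_cat mult_path_rcons mult_path_cons mult_path_rev revK.
by case: (z == x); case: (z == y); rewrite /= ?mul1n ?mul0n; lia.
Qed.

Lemma mult_closed x y z p : p != [::] ->
  mult x y (closed_edges (z :: p)) = mult x y (path_edges p)
    + (z == y) * ends x p + (z == x) * ends y p.
Proof.
case: p => [//|w p] _.
rewrite -[closed_edges _]/(path_edges (z :: rcons (w :: p) z)) mult_path_cons mult_path_rcons /ends.
by case: (z == x); case: (z == y); rewrite /= ?mul1n ?mul0n; lia.
Qed.

Lemma mult_path_notin x y p : y \notin p -> mult x y (path_edges p) = 0.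
Proof.
elim: p => [//|a p IHp]; rewrite inE negb_or => /andP[ya yp].
rewrite mult_path_cons IHp // eq_sym (negPf ya) /=.
case: p yp {IHp} => [|b p] /=; first by rewrite andbF.
by rewrite inE negb_or (inj_eq Some_inj) [b == y]eq_sym => /andP[/negPf -> _]; rewrite andbF.
Qed.

Lemma ohead_notin x p : x \notin p -> (ohead p == Some x) = false.
Proof.
by case: p => [|a p] //=; rewrite inE negb_or (inj_eq Some_inj) eq_sym => /andP[/negPf].
Qed.

Lemma ends_notin x p : x \notin p -> ends x p = 0.
Proof. by move=> xp; rewrite /ends !ohead_notin ?mem_rev. Qed.

Lemma mult_closed_notin x y c : y \notin c -> mult x y (closed_edges c) = 0.
Proof.
case: c => [//|z p]; rewrite -[closed_edges _]/(path_edges (rcons (z :: p) z)) => yc.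
by apply: mult_path_notin; rewrite mem_rcons inE negb_or yc andbT; move: yc; rewrite inE negb_or => /andP[].
Qed.

Lemma mult_path_loop x p : uniq p -> mult x x (path_edges p) = 0.
Proof.
elim: p => [//|a p IHp] /= /andP[ap up]; rewrite mult_path_cons IHp //.
case: (eqVneq a x) => [<-|//]; by rewrite ohead_notin.
Qed.

Lemma mult_closed_loop x c : 1 < size c -> uniq c -> mult x x (closed_edges c) = 0.
Proof.
case: c => [//|z [//|w p]] _ /andP[zp up]; rewrite mult_closed // mult_path_loop //.
by case: (eqVneq z x) => [<-|//]; rewrite ends_notin.
Qed.

Lemma degree_path x p : degree x (path_edges p) + ends x p = 2 * count_mem x p.
Proof.
case: p => [//|a p] /=; rewrite /degree /ends /= rev_cons.
have E1 s b : count (fun e => e.1 == x) (pairmap pair b s) = count_mem x (belast b s).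
  by elim: s b => //= c s IHs b; rewrite IHs.
have E2 s b : count (fun e => e.2 == x) (pairmap pair b s) = count_mem x s.
  by elim: s b => //= c s IHs b; rewrite IHs.
rewrite E1 E2 -rev_cons lastI rev_rcons /= !(inj_eq Some_inj).
have: count_mem x (a :: p) = count_mem x (rcons (belast a p) (last a p)) by rewrite -lastI.
by rewrite -cats1 count_cat /=; lia.
Qed.

Lemma degree_closed x c : degree x (closed_edges c) = 2 * count_mem x c.
Proof.
case: c => [//|z p].
have := degree_path x (rcons (z :: p) z).
rewrite -[closed_edges _]/(path_edges (rcons (z :: p) z)) /ends rev_rcons /= -cats1 count_cat /=.
by rewrite !(inj_eq Some_inj); lia.
Qed.

Lemma degree_sum x s l : uniq s -> (forall e, e \in l -> (e.1 \in s) && (e.2 \in s)) ->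
  \sum_(y <- s) mult x y l = degree x l.
Proof.
move=> us; elim: l => [|[a b] l IHl] sl; first by rewrite big1_eq.
under eq_bigr do rewrite mult_cons mult1E.
rewrite big_split /= IHl => [|e el]; last by apply: sl; rewrite inE el orbT.
have /andP[/= sa sb] := sl _ (mem_head _ _).
have count1 (d : T) : d \in s -> \sum_(y <- s) (d == y) = 1.
  move=> ds; under eq_bigr do rewrite eq_sym.
  by rewrite -big_mkcond sum1_count count_uniq_mem ?ds.
rewrite big_split /= /degree /=.
under eq_bigr do rewrite -mulnb. under [X in _ + X + _]eq_bigr do rewrite -mulnb.
by rewrite -big_distrr -big_distrl /= !count1 //; lia.
Qed.

Lemma path_edges_mem p e : e \in path_edges p -> (e.1 \in p) && (e.2 \in p).
Proof.
elim: p => [//|a p IHp]; rewrite path_edges_cons; case: p IHp => [//|b p] IHp.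
rewrite inE => /predU1P[->|/IHp/andP[e1 e2]]; first by rewrite !inE !eqxx !orbT.
by rewrite !(inE, e1, e2) ?orbT; move: e1 e2; rewrite !inE => -> ->; rewrite !orbT.
Qed.

Lemma closed_edges_mem c e : e \in closed_edges c -> (e.1 \in c) && (e.2 \in c).
Proof.
case: c => [//|z p]; rewrite -[closed_edges _]/(path_edges (rcons (z :: p) z)).
move/path_edges_mem; rewrite !mem_rcons !inE.
by rewrite !orbA !orbb.
Qed.

Lemma closed_edges_next c x y : uniq c ->
  ((x, y) \in closed_edges c) = (x \in c) && (y == next c x).
Proof.
have step z0 p z : uniq (z :: p) ->
    ((x, y) \in pairmap pair z (rcons p z0)) = (x \in z :: p) && (y == next_at x z0 z p).
  elim: p z => [|w p IHp] z /=.
    by move=> _; rewrite !inE xpair_eqE; case: eqVneq.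
  case/andP=> zp up; rewrite [(x, y) \in _]in_cons IHp // xpair_eqE [x \in z :: _]inE.
  case: (eqVneq x z) => [->|] //=.
  by rewrite (negPf zp) orbF.
by case: c => [//|z p]; apply: step.
Qed.

Lemma size_path_edges p : size (path_edges p) = (size p).-1.
Proof. by case: p => //= a p; rewrite size_pairmap. Qed.

Lemma size_closed_edges c : size (closed_edges c) = size c.
Proof. by case: c => //= a c; rewrite size_pairmap size_rcons. Qed.

End EdgeLists.

Section EdgeListsMap.
Variables (T T' : eqType) (g : T -> T').

Lemma path_edges_map p :
  path_edges (map g p) = [seq (g e.1, g e.2) | e <- path_edges p].
Proof. by case: p => //= a p; elim: p a => //= b p IHp a; rewrite IHp. Qed.

Lemma closed_edges_map c :
  closed_edges (map g c) = [seq (g e.1, g e.2) | e <- closed_edges c].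
Proof.
case: c => //= a c; rewrite -map_rcons; move: (rcons c a) => p.
by elim: p a => //= b p IHp a; rewrite IHp.
Qed.

Lemma mult_map x y l : injective g ->
  mult (g x) (g y) [seq (g e.1, g e.2) | e <- l] = mult x y l.
Proof.
move=> gI; rewrite /mult !count_map; congr (_ + _); apply: eq_count => -[a b] /=;
by rewrite !xpair_eqE !(inj_eq gI).
Qed.
End EdgeListsMap.

(** * Rado's theorem *)

(** The sets [S x] are shrunk to singletons while Hall's condition is kept: of two elements of one
    set, at least one can be deleted. The form is that of a polymatroid rank function, hence a
    conclusion on [f] of the image rather than on independence. *)
Theorem rado (X E : finType) (f : {set E} -> nat) :
  f set0 = 0 -> (forall A B : {set E}, A \subset B -> f A <= f B) ->
  (forall A B : {set E}, f (A :|: B) + f (A :&: B) <= f A + f B) ->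
  forall S : X -> {set E},
  (forall A : {set X}, #|A| <= f (\bigcup_(x in A) S x)) ->
  exists2 h : X -> E, forall x, h x \in S x & #|X| <= f (h @: [set: X]).
Proof.
move=> f0 fmono fsub S.
have [n] := ubnP (\sum_x #|S x|); elim: n S => // n IHn S leSn SH.
case: (pickP [pred x | 1 < #|S x|]) => [x /= /card_gt1P[a [b [aS bS ab]]] | small].
  pose del c y := if y == x then S y :\ c else S y.
  have reduce c : c \in S x -> (forall A : {set X}, #|A| <= f (\bigcup_(y in A) del c y)) ->
      exists2 h : X -> E, forall x, h x \in S x & #|X| <= f (h @: [set: X]).
    move=> cS /IHn[]; last first.
      move=> h hS hf; exists h => // y; move: (hS y); rewrite /del.
      by case: ifP => // _; rewrite inE => /andP[].
    rewrite ltnS in leSn; apply: leq_trans leSn; rewrite (bigD1 x) //= [X in _ < X](bigD1 x) //=.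
    rewrite {1}/del eqxx [X in _ < X + _](cardsD1 c) cS.
    suff -> : \sum_(i | i != x) #|del c i| = \sum_(i | i != x) #|S i| by lia.
    by apply: eq_bigr => y yx; rewrite /del (negPf yx).
  case: (boolP [forall A : {set X}, #|A| <= f (\bigcup_(y in A) del a y)]).
    by move/forallP; exact: reduce.
  move=> /forallPn[A]; rewrite -ltnNge => Aa.
  case: (boolP [forall A : {set X}, #|A| <= f (\bigcup_(y in A) del b y)]).
    by move/forallP; exact: reduce.
  move=> /forallPn[B]; rewrite -ltnNge => Bb.
  have xIn c (C : {set X}) : f (\bigcup_(y in C) del c y) < #|C| -> x \in C.
    move=> ltC; apply: contraLR ltC => xC; rewrite -leqNgt (leq_trans (SH C)) //.
    apply: fmono; apply/bigcupsP => y yC; apply: (bigcup_max y) => //.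
    by rewrite /del; case: eqP yC xC => // -> ->.
  (* As [a] and [b] differ, the union of the two reduced families still contains the full union over
     [A :|: B]. The intersection contains the sets of [A :&: B] other than [S x]. Hall's condition
     on both then contradicts submodularity. *)
  have := fsub (\bigcup_(y in A) del a y) (\bigcup_(y in B) del b y).
  have xA := xIn _ _ Aa; have xB := xIn _ _ Bb.
  have : #|A :|: B| <= f (\bigcup_(y in A) del a y :|: \bigcup_(y in B) del b y).
    apply: leq_trans (SH _) _; apply: fmono; apply/bigcupsP => y yAB.
    apply/subsetP => e eS; rewrite inE; apply/orP.
    case: (eqVneq y x) => [yx|yx].
      case: (eqVneq e a) => ea; [right | left]; apply/bigcupP; exists x => //;
        rewrite /del eqxx !inE -?yx eS ?ea ?ab //.
    move: yAB; rewrite inE => /orP[yA|yB]; [left | right]; apply/bigcupP; exists y => //;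
      by rewrite /del (negPf yx).
  have : #|(A :&: B) :\ x| <= f (\bigcup_(y in A) del a y :&: \bigcup_(y in B) del b y).
    apply: leq_trans (SH _) _; apply: fmono; apply/bigcupsP => y.
    rewrite !inE => /and3P[yx yA yB].
    rewrite subsetI; apply/andP; split; apply: (bigcup_max y) => //; by rewrite /del (negPf yx).
  have := cardsUI A B.
  have : #|A :&: B| = #|(A :&: B) :\ x|.+1 by rewrite (cardsD1 x) inE xA xB.
  lia.
have ne x : exists y, y \in S x.
  apply/set0Pn; apply/negP => /eqP Sx0; have := SH [set x].
  by rewrite cards1 big_set1 Sx0 f0.
have [h hS] := fin_all_exists ne; exists h => //.
apply: leq_trans (leq_trans (_ : _ <= #|[set: X]|) (SH setT)) _; first by rewrite cardsT.
apply: fmono; apply/bigcupsP => x _; apply/subsetP => y yS.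
move: (small x) => /= /negbT; rewrite -leqNgt => /card_le1_eqP/(_ _ _ yS (hS x)) <-.
by apply: imset_f.
Qed.

(** Rank test for the fractional solution: [m] parts with at most [k] half-edges each, every
    half-edge weighing [1 / n], have total weight at most [minn k m]. *)
Lemma leq_minn_mul k m n s : s <= k * m -> m <= n -> k <= n -> s <= minn k m * n.
Proof.
move=> skm mn kn; apply: leq_trans skm _; rewrite /minn; case: ifP => _.
  by rewrite leq_mul2l mn orbT.
by rewrite mulnC leq_mul2l kn orbT.
Qed.

(** * Transversals in sums of truncated partition matroids *)

Section CappedTransversal.
Variables (X E C P : finType) (col : E -> C) (pt : E -> P) (cap : C -> nat).

Definition parts c (A : {set E}) : {set P} := pt @: [set e in A | col e == c].

Lemma parts0 c : parts c set0 = set0.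
Proof. by apply/setP => p; rewrite inE; apply/negP => /imsetP[e]; rewrite !inE. Qed.

Lemma partsS c (A B : {set E}) : A \subset B -> parts c A \subset parts c B.
Proof.
move=> /subsetP sAB; apply: imsetS; apply/subsetP => e.
by rewrite !inE => /andP[/sAB -> ->].
Qed.

Lemma partsU c (A B : {set E}) : parts c (A :|: B) = parts c A :|: parts c B.
Proof.
rewrite /parts -imsetU.
suff -> : [set e in A :|: B | col e == c] =
          [set e in A | col e == c] :|: [set e in B | col e == c] by [].
by apply/setP => e; rewrite !inE andb_orl.
Qed.

Lemma partsI c (A B : {set E}) : parts c (A :&: B) \subset parts c A :&: parts c B.
Proof. by rewrite subsetI !partsS ?subsetIl ?subsetIr. Qed.

(** Rank function of a matroid: independent sets have at most [cap c] elements of colour [c], no two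
    of them in the same part. *)
Definition capped_rank (A : {set E}) := \sum_c minn (cap c) #|parts c A|.

(** Since [X] has the size of the total capacity, a Rado transversal is tight in every colour.
    Equality term by term forces exactly [cap c] choices, all in different parts. *)
Lemma capped_transversal (S : X -> {set E}) :
  #|X| = \sum_c cap c ->
  (forall A : {set X}, #|A| <= capped_rank (\bigcup_(x in A) S x)) ->
  exists2 h : X -> E, forall x, h x \in S x &
    forall c, #|[set x | col (h x) == c]| = cap c
           /\ {in [set x | col (h x) == c] &, injective (pt \o h)}.
Proof.
move=> cardX SH.
have [|A B sAB|A B|h hS hX] := @rado X E capped_rank _ _ _ S SH.
- by rewrite /capped_rank big1 // => c _; rewrite parts0 cards0 minn0.
- apply: leq_sum => c _; have := subset_leq_card (partsS c sAB); lia.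
- rewrite /capped_rank -!big_split; apply: leq_sum => c _ /=.
  rewrite partsU; have := cardsUI (parts c A) (parts c B).
  have := subset_leq_card (partsI c A B).
  have := subset_leq_card (subsetIl (parts c A) (parts c B)).
  have := subset_leq_card (subsetIr (parts c A) (parts c B)).
  lia.
exists h => //.
pose Xc c := [set x | col (h x) == c].
have partsE c : parts c (h @: [set: X]) = (pt \o h) @: Xc c.
  apply/setP => p; apply/imsetP/imsetP => -[z].
    rewrite inE => /andP[/imsetP[x _ ->] hc] ->; exists x => //; by rewrite inE.
  by rewrite inE => hc ->; exists (h z) => //; rewrite inE hc imset_f.
have le1 c : minn (cap c) #|parts c (h @: [set: X])| <= cap c by exact: geq_minl.
have le2 c : #|parts c (h @: [set: X])| <= #|Xc c| by rewrite partsE leq_imset_card.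
have sumX : \sum_c #|Xc c| = \sum_c cap c.
  rewrite -cardX -sum1_card (partition_big (col \o h) predT) //=.
  by apply: eq_bigr => c _; rewrite -sum1_card; apply: eq_bigl => x; rewrite inE.
have eq1 c : minn (cap c) #|parts c (h @: [set: X])| = cap c.
  have [_] := @leqif_sum C predT _ _ _ (fun c _ => leqif_eq (le1 c)).
  rewrite eqn_leq leq_sum //= -cardX hX => /esym/forall_inP/(_ c isT)/eqP //.
have le3 c : cap c <= #|Xc c| by have := eq1 c; have := le2 c; lia.
have eq3 c : cap c = #|Xc c|.
  have [_] := @leqif_sum C predT _ _ _ (fun c _ => leqif_eq (le3 c)).
  by rewrite sumX eqxx => /esym/forall_inP/(_ c isT)/eqP.
move=> c; split; first by rewrite -/(Xc c) -eq3.
apply/imset_injP; rewrite -/(Xc c) eqn_leq leq_imset_card -partsE.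
by rewrite -eq3; have := eq1 c; lia.
Qed.

End CappedTransversal.

(** * The two path ends chosen in each colour *)

Definition orient (e : bool) (p : seq nat) := if e then p else rev p.
(** A half-edge is the index of a path together with one of its two ends. A one-vertex path thus
    offers two half-edges at the same vertex. *)
Definition tip (ps : seq (seq nat)) (h : nat * bool) := ohead (orient h.2 (nth [::] ps h.1)).

Lemma ends_orient x e p : ends x (orient e p) = ends x p.
Proof. by case: e => //=; rewrite /ends revK addnC. Qed.

Lemma sum_ends x ps :
  \sum_(p <- ps) ends x p = \sum_(j < size ps) \sum_(e : bool) (tip ps (val j, e) == Some x).
Proof.
by rewrite (big_nth [::]) big_mkord; apply: eq_bigr => j _; rewrite big_bool.
Qed.

(* The matching plays the role of an extra colour [inr tt] of capacity [mu], whose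
   half-edges are the vertices of [U]; [None] labels the ends of empty paths. *)
Lemma select_ends (N t r : nat) (mu : bool) (ps : 'I_N -> seq (seq nat)) (U : seq nat) :
  r + t.+2 = (2 * N).+1 + mu ->
  (forall i, size (ps i) = t.+2) ->
  (forall i p x, p \in ps i -> x \in p -> x < r) ->
  size U = mu * t.+2 -> uniq U -> (forall x, x \in U -> x < r) ->
  (forall x, x < r -> \sum_i \sum_(p <- ps i) ends x p + (x \in U) = t.+2) ->
  exists (a b : 'I_N -> nat * bool) (U' : seq nat),
  [/\ forall i, [/\ (a i).1 < t.+2, (b i).1 < t.+2 & (a i).1 != (b i).1],
      [/\ size U' = mu * t.+1, uniq U' & {subset U' <= U}],
      (forall x, x < r -> \sum_i ((tip (ps i) (a i) == Some x) + (tip (ps i) (b i) == Some x))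
                          + (x \in U) = (x \in U') + 1) &
      \sum_i ((tip (ps i) (a i) == None) + (tip (ps i) (b i) == None)) = t.+1].
Proof.
move=> rt psz psr Usz Uu Ur endsE.
pose E := (('I_N + unit) * 'I_t.+2 * bool)%type.
pose col (h : E) := h.1.1; pose pt (h : E) := h.1.2.
pose cap (c : 'I_N + unit) := if c is inl _ then 2 else mu : nat.
(* [Some r] is a dummy label: no index asks for it. It marks the half-edges of the matching colour
   that stand for no vertex of [U]. *)
pose lab (h : E) := match col h with
  | inl i => tip (ps i) (val (pt h), h.2)
  | inr _ => if h.2 && (pt h < size U) then Some (nth 0 U (pt h)) else Some r end.
(* [2 * N + mu] is both the total capacity and [r + t.+1]. The first [r] indices ask for an end at
   the vertex of that number, the other [t.+1] for an end of an empty path. *)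
pose S (x : 'I_(2 * N + mu)) : {set E} :=
  [set h | lab h == if x < r then Some (val x) else None].
have sumE (F : E -> nat) : \sum_h F h =
    \sum_i \sum_j \sum_e F (inl i, j, e) + \sum_j \sum_e F (inr tt, j, e).
  transitivity (\sum_(cj : ('I_N + unit) * 'I_t.+2) \sum_e F (cj, e)).
    by rewrite pair_bigA; apply: eq_bigr => -[].
  transitivity (\sum_(c : 'I_N + unit) \sum_(j < t.+2) \sum_e F (c, j, e)).
    by rewrite [RHS]pair_bigA; apply: eq_bigr => -[].
  rewrite big_sumType /=.
  by congr (_ + _); rewrite (big_pred1 tt) // => -[].
have tip_lt i j e x : tip (ps i) (val (j : 'I_t.+2), e) = Some x -> x < r.
  rewrite /tip => H; apply: (psr i (nth [::] (ps i) j)); first by rewrite mem_nth // psz.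
  move: H => /=; case: e => /=; first by case: nth => //= w p [->]; rewrite mem_head.
  by rewrite -mem_rev; case: rev => //= w p [->]; rewrite mem_head.
have nthU x : \sum_(j < t.+2) ((j < size U) && (nth 0 U j == x)) = (x \in U).
  have [/size0nil ->|U1] : size U = 0 \/ size U = t.+2 by move: Usz; case: (mu); lia.
    by rewrite big1.
  rewrite -count_uniq_mem // -sum1_count [RHS]big_mkcond (big_nth 0) big_mkord U1.
  by apply: eq_bigr => j _; rewrite ltn_ord /=; case: eqP.
have labS x : x < r -> \sum_h (lab h == Some x) = t.+2.
  move=> xr; rewrite sumE; apply: etrans (endsE x xr); congr (_ + _).
    by apply: eq_bigr => i _; rewrite sum_ends psz.
  rewrite -nthU; apply: eq_bigr => j _; rewrite big_bool /lab /=.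
  have rx : (Some r == Some x) = false by apply/eqP => -[] ?; lia.
  by case: ltnP => _; rewrite /= ?rx addn0.
(* Of the [2 * N * t.+2] ends in the colours, [r * t.+2 - size U] lie at vertices; the rest belong
   to empty paths. *)
have labN : \sum_h (lab h == None) = t.+2 * t.+1.
  have tot i j e : (tip (ps i) (val (j : 'I_t.+2), e) == None)
       + \sum_(x < r) (tip (ps i) (val j, e) == Some (val x)) = 1.
    case E1 : (tip _ _) => [x|]; last by rewrite big1.
    have xr := tip_lt _ _ _ _ E1.
    rewrite add0n (bigD1 (Ordinal xr)) //= (inj_eq Some_inj) eqxx big1 // => y.
    by rewrite (inj_eq Some_inj) eq_sym -val_eqE /= => /negPf ->.
  have : \sum_(i < N) \sum_(j < t.+2) \sum_e (tip (ps i) (val j, e) == None)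
       + \sum_(i < N) \sum_(j < t.+2) \sum_e \sum_(x < r) (tip (ps i) (val j, e) == Some (val x))
       = N * (t.+2 * 2).
    rewrite -[N in RHS]card_ord -sum_nat_const -big_split; apply: eq_bigr => i _ /=.
    rewrite -[X in _ = X * _]card_ord -sum_nat_const -big_split; apply: eq_bigr => j _ /=.
    by rewrite -big_split big_bool /= !tot.
  have -> : \sum_i \sum_j \sum_e \sum_(x < r) (tip (ps i) (val (j : 'I_t.+2), e) == Some (val x))
     = \sum_(x < r) (t.+2 - (val x \in U)).
    transitivity (\sum_(i < N) \sum_(x < r) \sum_(p <- ps i) ends (nat_of_ord x) p).
      apply: eq_bigr => i _; under [RHS]eq_bigr do rewrite sum_ends psz.
      by rewrite [RHS]exchange_big; apply: eq_bigr => j _; apply: exchange_big.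
    rewrite exchange_big /=; apply: eq_bigr => x _.
    by rewrite -(endsE x (ltn_ord x)) addnK.
  have -> : \sum_(x < r) (t.+2 - (val x \in U)) = r * t.+2 - size U.
    rewrite sumnB => [|x _]; last by case: (_ \in _).
    rewrite sum_nat_const card_ord; congr (_ - _).
    rewrite -(big_mkord predT (fun x => (x \in U) : nat)) -big_mkcond sum1_count.
    rewrite -size_filter; apply: perm_size; apply: uniq_perm => //.
      by rewrite filter_uniq ?iota_uniq.
    by move=> x; rewrite mem_filter mem_index_iota /=; case: (boolP (x \in U)) => //= /Ur ->.
  have -> : \sum_h (lab h == None) =
      \sum_(i < N) \sum_(j < t.+2) \sum_e (tip (ps i) (val j, e) == None).
    by rewrite sumE [X in _ + X]big1 ?addn0 // => j _; rewrite big_bool /lab /=; case: ifP.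
  rewrite Usz; set Z := \sum_(i < N) _ => HZ.
  have : t.+2 * r + t.+2 * t.+1 = t.+2 * (2 * N) + t.+2 * mu.
    by rewrite -!mulnDr; congr (_ * _); lia.
  have : size U <= r.
    rewrite -[r](size_iota 0); apply: uniq_leq_size => // x /Ur; by rewrite mem_iota.
  have : r <= r * t.+2 by rewrite leq_pmulr.
  rewrite Usz; lia.
have Hall (A : {set 'I_(2 * N + mu)}) : #|A| <= capped_rank col pt cap (\bigcup_(x in A) S x).
  set SA := \bigcup_(x in A) S x.
  have lower : t.+2 * #|A| <= \sum_h (h \in SA).
    (* An end of an empty path serves all [t.+1] indices from [r] on, any other half-edge at most
       one index. The weight [w] evens this out: every index receives total weight [t.+1 * t.+2]. *)
    pose w h := if lab h == None then 1 else t.+1.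
    have E1 h : w h * \sum_(x in A) (h \in S x) <= t.+1 * (h \in SA).
      case: (boolP (h \in SA)) => [_|hn]; last first.
        rewrite big1 ?muln0 // => x xA; case: (boolP (h \in S x)) => // hS.
        by case/negP: hn; apply/bigcupP; exists x.
      rewrite muln1 /w; case: eqP => [hN|/eqP hN].
        rewrite mul1n; apply: leq_trans (_ : \sum_(x < 2 * N + mu) (r <= x) <= _).
          rewrite big_mkcond; apply: leq_sum => x _; case: (x \in A) => //.
          by rewrite inE hN; case: ltnP.
        rewrite -(big_mkord predT (fun x => (r <= x) : nat)) (@big_cat_nat _ _ _ r) //=; last lia.
        rewrite big_nat_cond big1 => [|x /andP[/andP[_ xr] _]]; last by rewrite leqNgt xr.
        rewrite add0n (leq_trans (_ : _ <= \sum_(r <= x < 2 * N + mu) 1)) //.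
          by apply: leq_sum => x _; case: (r <= x).
        by rewrite sum_nat_const_nat; lia.
      rewrite -[X in _ <= X]muln1 leq_mul2l /=.
      case labh: (lab h) hN => [y|//] _.
      case: (ltnP y (2 * N + mu)) => yN; last first.
        rewrite big1 // => x _; rewrite inE labh; case: ltnP => // xr.
        apply/eqP; rewrite eqb0 (inj_eq Some_inj); apply: contraL yN => /eqP ->.
        by rewrite -ltnNge ltn_ord.
      rewrite big_mkcond (bigD1 (Ordinal yN)) //= big1 ?addn0; last first.
        move=> x xy; case: (x \in A) => //; rewrite inE labh; case: ltnP => // xr.
        apply/eqP; rewrite eqb0 (inj_eq Some_inj) eq_sym; apply: contraNneq xy => xy.
        by apply/eqP/val_inj.
      by case: ifP => // _; case: (_ \in _).
    have : \sum_h w h * \sum_(x in A) (h \in S x) <= \sum_h t.+1 * (h \in SA) by apply: leq_sum.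
    under eq_bigr do rewrite big_distrr /=.
    rewrite exchange_big /= -[in X in _ <= X]big_distrr /=.
    rewrite (eq_bigr (fun=> t.+1 * t.+2)) => [|x xA].
      by rewrite sum_nat_const mulnC -mulnA leq_mul2l.
    case: (ltnP x r) => xr.
      transitivity (t.+1 * \sum_h (lab h == Some (val x))); last by rewrite labS.
      rewrite big_distrr /=; apply: eq_bigr => h _; rewrite inE xr /w.
      by case: (eqVneq (lab h) (Some (val x))) => [->|_] //; rewrite !muln0.
    transitivity (\sum_h (lab h == None)); last by rewrite labN mulnC.
    apply: eq_bigr => h _; rewrite inE ltnNge xr /= /w.
    by case: (lab h == None); rewrite ?muln0.
  (* A colour has at most [t.+2] parts, each with at most two half-edges in [SA]. In the matching
     colour it is at most one, the second carrying the dummy label. *)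
  suff upper : \sum_h (h \in SA) <= t.+2 * capped_rank col pt cap SA.
    by move: (leq_trans lower upper); rewrite leq_mul2l.
  have inparts c j e : (c, j, e) \in SA -> j \in parts col pt c SA.
    by move=> cj; apply/imsetP; exists (c, j, e); rewrite // inE cj /=.
  have leparts c : #|parts col pt c SA| <= t.+2.
    by rewrite -[X in _ <= X]card_ord max_card.
  rewrite sumE mulnC /capped_rank big_distrl big_sumType /= leq_add //.
    apply: leq_sum => i _.
    have : \sum_(j < t.+2) \sum_e ((inl i, j, e) \in SA) <= 2 * #|parts col pt (inl i) SA|.
      rewrite -sum1_card big_distrr /= [X in _ <= X]big_mkcond; apply: leq_sum => j _.
      rewrite big_bool; case: (boolP (j \in _)) => [_|jn]; first by do 2!case: (_ \in SA).
      have notin e : ((inl i, j, e) \in SA) = false by apply: contraNF jn => /inparts.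
      by rewrite !notin.
    by move=> /leq_minn_mul; apply.
  rewrite (big_pred1 tt) => [|[]//].
  have notSA j : (inr tt, j, false) \notin SA.
    apply/negP => /bigcupP[x xA]; rewrite inE /lab /=; case: ltnP => // xr.
    by rewrite (inj_eq Some_inj) => /eqP; lia.
  case: (posnP mu) => mu0.
    have U0 : size U = 0 by rewrite Usz mu0.
    rewrite big1 => [|j _]; first by [].
    rewrite big_bool (negPf (notSA j)) /= addn0; apply/eqP; rewrite eqb0.
    apply/negP => /bigcupP[x xA]; rewrite inE /lab /= U0 ltn0; case: ltnP => // xr.
    by rewrite (inj_eq Some_inj) => /eqP; lia.
  rewrite (_ : nat_of_bool mu = 1); last by move: mu0; case: (mu).
  apply: leq_minn_mul => //.
  have : \sum_(j < t.+2) \sum_e ((inr tt, j, e) \in SA) <= #|parts col pt (inr tt) SA|.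
    rewrite -sum1_card [X in _ <= X]big_mkcond; apply: leq_sum => j _.
    rewrite big_bool (negPf (notSA j)) /= addn0.
    by case: (boolP (_ \in SA)) => // /inparts ->.
  by rewrite mul1n.
have [|h hS hc] := capped_transversal _ Hall.
  rewrite card_ord big_sumType /= (big_pred1 tt) => [|[]//].
  by rewrite sum_nat_const card_ord mulnC.
have labh x : lab (h x) = if x < r then Some (val x) else None.
  by move: (hS x); rewrite inE => /eqP.
have two i : exists ab : 'I_(2 * N + mu) * 'I_(2 * N + mu),
    [/\ ab.1 != ab.2, [set x | col (h x) == inl i] = [set ab.1; ab.2] &
        pt (h ab.1) != pt (h ab.2)].
  have [/eqP/cards2P[x [y [xy XE]]] inj] := hc (inl i).
  exists (x, y); split => //=; apply: contraNneq xy => pxy.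
  by apply/eqP; apply: inj; rewrite ?XE ?inE ?eqxx ?orbT.
have [ab abP] := fin_all_exists two.
pose pick x := (val (pt (h x)), (h x).2).
have tipE i x : x \in [set x | col (h x) == inl i] -> tip (ps i) (pick x) = lab (h x).
  by rewrite inE /lab => /eqP ->.
have pickE i o : (tip (ps i) (pick (ab i).1) == o) + (tip (ps i) (pick (ab i).2) == o)
    = \sum_(x | col (h x) == inl i) (lab (h x) == o).
  have [xy XE _] := abP i.
  rewrite (eq_bigl (fun x => x \in [set x | col (h x) == inl i])) => [|x]; last by rewrite inE.
  rewrite XE big_setU1 ?inE //= big_set1; congr (_ + _); by rewrite tipE // XE !inE eqxx ?orbT.
pose Xm := [set x | col (h x) == inr tt].
have pickS o : \sum_i \sum_(x | col (h x) == inl i) (lab (h x) == o) + \sum_(x in Xm) (lab (h x) == o)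
    = \sum_x (lab (h x) == o).
  rewrite [RHS](partition_big (col \o h) predT) //= big_sumType /=; congr (_ + _).
  by rewrite (big_pred1 tt) => [|[]//]; apply: eq_bigl => x; rewrite inE.
have XmU x : x \in Xm -> val x \in U.
  rewrite inE => /eqP cx; have := labh x; rewrite /lab cx.
  case: ifP => [/andP[_ hx]|_]; case: ltnP => // xr [].
    by move=> xE; rewrite -[val x]xE mem_nth.
  by lia.
(* The matching colour is used exactly [mu] times. If once, the vertex chosen is the partner of the
   new vertex and leaves [U]. *)
have [U' [U's U'u U'sub U'E]] : exists U', [/\ size U' = mu * t.+1, uniq U', {subset U' <= U} &
    forall x, x < r -> (x \in U : nat) = (x \in U') + \sum_(z in Xm) (lab (h z) == Some x)].
  have [cXm _] := hc (inr tt); rewrite -/Xm /= in cXm.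
  have [mu1|mu0] : nat_of_bool mu = 1 \/ nat_of_bool mu = 0 by case: (mu); [left | right].
    have /eqP/cards1P[m mE] := etrans cXm mu1.
    have mU := XmU m; rewrite mE inE eqxx in mU; have {}mU := mU isT.
    exists (rem (val m) U); split; rewrite ?rem_uniq //.
    - by rewrite size_rem // Usz mu1; lia.
    - by move=> x; apply: mem_rem.
    - move=> x xr; rewrite mE big_set1 labh Ur // (inj_eq Some_inj) mem_rem_uniq // inE.
      by rewrite eq_sym; case: eqVneq => [<-|]; rewrite ?mU ?addn0.
  have /eqP := etrans cXm mu0; rewrite cards_eq0 => /eqP Xm0.
  have /size0nil U0 : size U = 0 by rewrite Usz mu0.
  by exists [::]; split => [|||x _]; rewrite ?mu0 ?Xm0 ?big_set0 ?U0.
exists (fun i => pick (ab i).1), (fun i => pick (ab i).2), U'; split => //.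
- by move=> i; have [_ _ neq] := abP i; rewrite /= !ltn_ord.
- move=> x xr; under eq_bigr do rewrite pickE.
  rewrite U'E // [(_ \in _) + _]addnC addnA pickS addnC; congr (_ + _).
  have xN : x < 2 * N + mu by lia.
  rewrite (bigD1 (Ordinal xN)) //= labh /= xr eqxx big1 // => y yx; rewrite labh.
  case: ltnP => // yr; apply/eqP; rewrite eqb0 (inj_eq Some_inj).
  by apply: contraNneq yx => yx; apply/eqP/val_inj.
under eq_bigr do rewrite pickE.
have := pickS None; rewrite [X in _ + X]big1 ?addn0 => [->|x xm]; last first.
  by rewrite labh Ur // XmU.
under eq_bigr do rewrite labh.
rewrite (eq_bigr (fun x : 'I__ => (r <= x) : nat)) => [|x _]; last by case: ltnP.
rewrite -(big_mkord predT (fun x => (r <= x) : nat)) (@big_cat_nat _ _ _ r) //=; last lia.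
rewrite big_nat_cond big1 => [|x /andP[/andP[_ xr] _]]; last by rewrite leqNgt xr.
rewrite big_nat_cond (eq_bigr (fun=> 1)) => [|x /andP[/andP[-> //]]].
by rewrite -big_nat_cond sum_nat_const_nat; lia.
Qed.

(** * Adding a vertex *)

Lemma perm_take2 (T : eqType) (x0 : T) (s : seq T) j k :
  j < size s -> k < size s -> j != k ->
  exists rest, perm_eq s [:: nth x0 s j, nth x0 s k & rest].
Proof.
move=> js ks jk; exists [seq nth x0 s i | i <- rem k (rem j (iota 0 (size s)))].
rewrite -[s in perm_eq s _](mkseq_nth x0) -!map_cons perm_map //.
have jI : j \in iota 0 (size s) by rewrite mem_iota.
have kI : k \in rem j (iota 0 (size s)).
  by rewrite mem_rem_uniq ?iota_uniq // !inE mem_iota eq_sym jk.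
by rewrite (perm_trans (perm_to_rem jI)) // perm_cons perm_to_rem.
Qed.

Definition join (z : nat) (p q : seq nat) := rev p ++ z :: q.

(** The joined heads cease to be ends, and [z] becomes an end once for each empty piece. Joining two
    empty paths thus gives the one-vertex path with its two ends. *)
Lemma ends_join x z p q :
  ends x (join z p q) + (ohead p == Some x) + (ohead q == Some x) =
  ends x p + ends x q + (z == x) * ((ohead p == None) + (ohead q == None)).
Proof.
rewrite /ends /join rev_cat rev_cons revK.
have oheadE (s s' : seq nat) : ohead (rev s ++ z :: s') = if s is [::] then Some z else ohead (rev s).
  by case/lastP: s => // s a; rewrite rev_rcons; case: s.
have -> : rcons (rev q) z ++ p = rev q ++ z :: p by rewrite cat_rcons.
rewrite !oheadE; case: p q => [|a p] [|b q] /=; rewrite ?(inj_eq Some_inj); lia.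
Qed.

Lemma merge_paths (z : nat) (ps : seq (seq nat)) (a b : nat * bool) :
  a.1 < size ps -> b.1 < size ps -> a.1 != b.1 ->
  exists ps', [/\ (size ps').+1 = size ps,
    perm_eq (flatten ps') (z :: flatten ps),
    (forall x y, \sum_(p <- ps') mult x y (path_edges p) =
       \sum_(p <- ps) mult x y (path_edges p)
       + (z == y) * ((tip ps a == Some x) + (tip ps b == Some x))
       + (z == x) * ((tip ps a == Some y) + (tip ps b == Some y))) &
    (forall x, \sum_(p <- ps') ends x p + ((tip ps a == Some x) + (tip ps b == Some x)) =
       \sum_(p <- ps) ends x p + (z == x) * ((tip ps a == None) + (tip ps b == None)))].
Proof.
case: a b => [j e] [k f] /= js ks jk.
have [rest psE] := perm_take2 [::] js ks jk.
rewrite /tip /=; set p := nth _ _ j in psE *; set q := nth _ _ k in psE *; clearbody p q.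
exists (join z (orient e p) (orient f q) :: rest); split.
- by rewrite (perm_size psE).
- apply/permP => A; have /permP/(_ A) := perm_flatten psE.
  have countE g s : count A (orient g s) = count A s by case: g => //=; rewrite count_rev.
  by rewrite /= /join !count_cat /= count_rev !countE => ->; rewrite addnCA -!addnA.
- move=> x y; rewrite (perm_big _ psE) /= !big_cons mult_path_join.
  have multE g s : mult x y (path_edges (orient g s)) = mult x y (path_edges s).
    by case: g => //=; rewrite mult_path_rev.
  by rewrite !multE; move: (_ * _) (_ * _) (\sum_(_ <- _) _) => A B C; lia.
- move=> x; rewrite (perm_big _ psE) /= !big_cons.
  have := ends_join x z (orient e p) (orient f q); rewrite !ends_orient.
  by move: (_ * _) (ohead _ == Some x) (ohead (orient f q) == Some x) => A B C; lia.
Qed.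

(** * Stages of the embedding *)

Section Embedding.
Variables (N : nat) (mu : bool) (cs : 'I_N -> seq (seq nat)).

(* An edge colouring of the complete graph on [r] vertices in which colour [i] consists of
   the cycles [cs i] and of exactly [t] paths, possibly empty or reduced to a vertex; [U]
   is the set of vertices not yet saturated by the matching (empty if [mu] is false). *)
Record stage (r t : nat) (ps : 'I_N -> seq (seq nat)) (U : seq nat) : Prop := Stage {
  stage_size : forall i, size (ps i) = t;
  stage_perm : forall i, perm_eq (flatten (cs i) ++ flatten (ps i)) (iota 0 r);
  stage_mult : forall x y, x < r -> y < r -> x != y ->
    \sum_i (\sum_(c <- cs i) mult x y (closed_edges c)
            + \sum_(p <- ps i) mult x y (path_edges p)) <= 1;
  stage_unmatched : [/\ size U = mu * t, uniq U & forall x, x \in U -> x < r];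
  stage_ends : forall x, x < r -> \sum_i \sum_(p <- ps i) ends x p + (x \in U) = t }.

Lemma stage_mem r t ps U i x : stage r t ps U ->
  (x \in flatten (cs i)) || (x \in flatten (ps i)) = (x < r).
Proof. by case=> _ /(_ i)/perm_mem/(_ x); rewrite mem_cat mem_iota. Qed.

Lemma stage_new r t ps U i x :
  stage r t ps U ->
  [/\ \sum_(c <- cs i) mult x r (closed_edges c) = 0,
      \sum_(p <- ps i) mult x r (path_edges p) = 0 &
      \sum_(p <- ps i) ends r p = 0].
Proof.
move=> st; have := stage_mem i r st; rewrite ltnn => /negbT; rewrite negb_or => /andP[rc rp].
split; apply: big1_seq => c /andP[_ cin].
- by apply: mult_closed_notin; apply: contra rc => rc; apply/flattenP; exists c.
- by apply: mult_path_notin; apply: contra rp => rp; apply/flattenP; exists c.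
- by apply: ends_notin; apply: contra rp => rp; apply/flattenP; exists c.
Qed.

(** The new vertex [r] gets one edge to each old vertex except the one leaving [U]. It is itself an
    end once for each chosen end of an empty path, hence [t.+1] times, as the next stage demands. *)
Lemma stage_step r t ps U :
  r + t.+2 = (2 * N).+1 + mu -> stage r t.+2 ps U ->
  exists ps' U', stage r.+1 t.+1 ps' U'.
Proof.
move=> rt st; have [psz pp pm [Usz Uu Ur] pe] := st.
have psr i p x : p \in ps i -> x \in p -> x < r.
  move=> pi xp; rewrite -(stage_mem i x st); apply/orP; right; apply/flattenP; by exists p.
have [a [b [U' [abP [U's U'u U'sub] tipS tipN]]]] := select_ends rt psz psr Usz Uu Ur pe.
have merge i : exists ps', [/\ (size ps').+1 = size (ps i),
    perm_eq (flatten ps') (r :: flatten (ps i)),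
    (forall x y, \sum_(p <- ps') mult x y (path_edges p) =
       \sum_(p <- ps i) mult x y (path_edges p)
       + (r == y) * ((tip (ps i) (a i) == Some x) + (tip (ps i) (b i) == Some x))
       + (r == x) * ((tip (ps i) (a i) == Some y) + (tip (ps i) (b i) == Some y))) &
    (forall x, \sum_(p <- ps') ends x p
       + ((tip (ps i) (a i) == Some x) + (tip (ps i) (b i) == Some x)) =
       \sum_(p <- ps i) ends x p
       + (r == x) * ((tip (ps i) (a i) == None) + (tip (ps i) (b i) == None)))].
  by have [ai bi ab] := abP i; apply: merge_paths; rewrite ?psz.
have [ps' ps'P] := fin_all_exists merge.
have new x : x < r -> \sum_i (\sum_(c <- cs i) mult x r (closed_edges c)
            + \sum_(p <- ps' i) mult x r (path_edges p)) <= 1.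
  move=> xr; rewrite (eq_bigr (fun i => (tip (ps i) (a i) == Some x) + (tip (ps i) (b i) == Some x))).
    have := tipS x xr; have := U'sub x; move: (\sum_i _) => n.
    by case: (x \in U'); case: (x \in U) => // H; lia.
  move=> i _; have [_ _ -> _] := ps'P i; have [-> -> _] := stage_new i x st.
  by rewrite eqxx (gtn_eqF xr) !(add0n, addn0, mul1n, mul0n).
exists ps', U'; split.
- by move=> i; have [sz _ _ _] := ps'P i; move: sz; rewrite psz => -[].
- move=> i; have [_ fl _ _] := ps'P i.
  rewrite -addn1 iotaD /= add0n perm_catC.
  apply: perm_trans (perm_cat fl (perm_refl _)) _.
  by rewrite /= perm_sym perm_catC /= perm_cons perm_sym perm_catC.
- move=> x y; rewrite ltnS leq_eqVlt => /predU1P[->|xr];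
    rewrite ltnS leq_eqVlt => /predU1P[->|yr] xy.
  + by rewrite eqxx in xy.
  + under eq_bigr do (under eq_bigr do rewrite mult_sym;
      under [X in _ + X]eq_bigr do rewrite mult_sym).
    exact: new.
  + exact: new.
  rewrite (leq_trans _ (pm x y xr yr xy)) //; apply: leq_sum => i _.
  by have [_ _ -> _] := ps'P i; rewrite (gtn_eqF xr) (gtn_eqF yr) !mul0n !addn0.
- by split => // x /U'sub/Ur; lia.
move=> x; rewrite ltnS leq_eqVlt => /predU1P[->|xr].
  have -> : r \in U' = false.
    by apply/negP => /U'sub/Ur; rewrite ltnn.
  rewrite addn0 -tipN; apply: eq_bigr => i _.
  have [_ _ _ /(_ r)] := ps'P i; have [_ _ ->] := stage_new i r st.
  rewrite eqxx mul1n add0n.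
  have tipr h : h.1 < t.+2 -> (tip (ps i) h == Some r) = false.
    move=> hs; apply/negP; rewrite /tip => /eqP H.
    have: r \in nth [::] (ps i) h.1.
      move: H; case: h.2 => /=; first by case: nth => //= w p [->]; rewrite mem_head.
      by rewrite -[r \in _]mem_rev; case: rev => //= w p [->]; rewrite mem_head.
    by move/psr => /(_ i); rewrite mem_nth ?psz // ltnn => /(_ isT).
  by have [ai bi _] := abP i; rewrite !tipr // addn0.
have : \sum_i (\sum_(p <- ps' i) ends x p
    + ((tip (ps i) (a i) == Some x) + (tip (ps i) (b i) == Some x)))
  = \sum_i \sum_(p <- ps i) ends x p.
  apply: eq_bigr => i _; have [_ _ _ ->] := ps'P i; by rewrite (gtn_eqF xr) mul0n addn0.
rewrite big_split /=; move: (tipS x xr) (pe x xr).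
move: (\sum_i \sum_(p <- ps i) _) (\sum_i (_ + _)) (\sum_i \sum_(p <- ps' i) _) => n1 n2 n3.
by case: (x \in U) => /=; case: (x \in U') => /=; lia.
Qed.

(** The descent stops with one vertex missing, because merging takes two paths of each colour. *)
Lemma stage_embed r t ps U :
  r + t.+1 = (2 * N).+1 + mu -> stage r t.+1 ps U ->
  exists ps' U', stage (2 * N + mu) 1 ps' U'.
Proof.
elim: t r ps U => [|t IHt] r ps U rt st.
  by exists ps, U; have -> : 2 * N + mu = r by lia.
have [ps' [U' st']] := stage_step rt st.
by apply: IHt st'; lia.
Qed.

(** The single path left in a colour holds the [y - 1] vertices outside the cycles. At [t = 1],
    [stage_ends] makes each old vertex an end at most once over all colours, so no edge to the last
    vertex is repeated. *)
Lemma stage_close r ps U ls y :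
  (forall i, map size (cs i) = ls) -> r.+1 = y + sumn ls -> 1 < y ->
  stage r 1 ps U ->
  exists cs' : 'I_N -> seq (seq nat),
  [/\ forall i, map size (cs' i) = y :: ls,
      forall i, perm_eq (flatten (cs' i)) (iota 0 r.+1) &
      forall x y, x < r.+1 -> y < r.+1 -> x != y ->
        \sum_i \sum_(c <- cs' i) mult x y (closed_edges c) <= 1].
Proof.
move=> cls ry y1 st; have [psz pp pm [Usz Uu Ur] pe] := st.
pose p i := nth [::] (ps i) 0.
have psE i : ps i = [:: p i] by have := psz i; rewrite /p; case: (ps i) => [|q []].
have sp i : (size (p i)).+1 = y.
  have := perm_size (pp i); rewrite psE /= cats0 size_cat size_flatten /shape cls size_iota; lia.
have p0 i : p i != [::] by have := sp i; case: (p i) => //= yE; rewrite -yE in y1.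
have new x : x < r ->
    \sum_i \sum_(c <- (r :: p i) :: cs i) mult x r (closed_edges c) <= 1.
  move=> xr; apply: leq_trans (_ : \sum_i \sum_(q <- ps i) ends x q <= 1); last first.
    by rewrite -[X in _ <= X](pe x xr) leq_addr.
  apply: leq_sum => i _; have [E1 E2 _] := stage_new i x st.
  rewrite big_cons E1 mult_closed // eqxx (gtn_eqF xr) mul1n mul0n !addn0.
  by move: E2; rewrite psE !big_seq1 => ->.
exists (fun i => (r :: p i) :: cs i); split.
- by move=> i /=; rewrite cls sp.
- move=> i; rewrite -addn1 iotaD /= add0n perm_sym perm_catC /= perm_cons perm_sym.
  by have := pp i; rewrite psE /= cats0 perm_catC.
move=> x z; rewrite ltnS leq_eqVlt => /predU1P[->|xr];
  rewrite ltnS leq_eqVlt => /predU1P[->|zr] xz.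
- by rewrite eqxx in xz.
- under eq_bigr do under eq_bigr do rewrite mult_sym.
  exact: new.
- exact: new.
rewrite (leq_trans _ (pm x z xr zr xz)) //; apply: leq_sum => i _.
rewrite big_cons mult_closed // (gtn_eqF xr) (gtn_eqF zr) psE big_seq1 !mul0n !addn0.
by rewrite addnC.
Qed.

End Embedding.

(** * From cycle systems to the Oberwolfach problem *)

Lemma lift_ord v (s : seq nat) : all (fun n => n < v) s ->
  exists s' : seq 'I_v, map val s' = s.
Proof.
elim: s => [|n s IHs] /=; first by exists [::].
by case/andP=> nv /IHs[s' <-]; exists (Ordinal nv :: s').
Qed.

Lemma lift_ord2 v (ss : seq (seq nat)) : all (fun n => n < v) (flatten ss) ->
  exists ss' : seq (seq 'I_v), map (map val) ss' = ss.
Proof.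
elim: ss => [|s ss IHss] /=; first by exists [::].
rewrite all_cat => /andP[/lift_ord[s' <-] /IHss[ss' <-]].
by exists (s' :: ss').
Qed.

Lemma flatten_uniq_mem (T : eqType) (ss : seq (seq T)) s :
  uniq (flatten ss) -> s \in ss -> uniq s.
Proof.
elim: ss => //= s' ss IHss; rewrite cat_uniq inE => /and3P[us' _ /IHss uss].
by case/predU1P=> [->|].
Qed.

Lemma bigcup_seqP (I : eqType) (T : finType) (s : seq I) (F : I -> {set T}) e :
  reflect (exists2 c, c \in s & e \in F c) (e \in \bigcup_(c <- s) F c).
Proof.
apply: (iffP idP) => [|[c cs ec]]; last by rewrite (big_rem c) //= inE ec.
elim: s => [|c s IHs]; first by rewrite big_nil inE.
rewrite big_cons inE => /orP[ec|/IHs[d ds ed]].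
  by exists c; rewrite ?mem_head.
by exists d; rewrite // inE ds orbT.
Qed.

(** Multiplicity at most one suffices: a vertex has degree 2 in each of the [N] colours, so it is
    joined to [2 * N] of the [2 * N + mu] others and misses exactly [mu]. The uncovered pairs are
    the one-factor when [mu = 1], and there are none otherwise. *)
Lemma OP_of_cycles N (mu : bool) (ms : seq nat) (cs : 'I_N -> seq (seq nat)) :
  let v := sumn ms in
  v = (2 * N).+1 + mu -> all (leq 3) ms ->
  (forall i, map size (cs i) = ms) ->
  (forall i, perm_eq (flatten (cs i)) (iota 0 v)) ->
  (forall x y, x < v -> y < v -> x != y ->
     \sum_i \sum_(c <- cs i) mult x y (closed_edges c) <= 1) ->
  OP_solvable ms.
Proof.
move=> v vE ms3 csz cperm cmult.
have /fin_all_exists[ds dsE] i : exists ds : seq (seq 'I_v), map (map val) ds = cs i.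
  by apply: lift_ord2; rewrite (perm_all _ (cperm i)); apply/allP => n; rewrite mem_iota.
have dsz i : map size (ds i) = ms.
  rewrite -(csz i) -dsE -map_comp; apply: eq_map => c /=; by rewrite size_map.
have dperm i : perm_eq (map val (flatten (ds i))) (iota 0 v).
  by rewrite map_flatten dsE.
have duniq i : uniq (flatten (ds i)).
  by rewrite -(map_inj_uniq val_inj) (perm_uniq (dperm i)) iota_uniq.
have dsize i : size (flatten (ds i)) = v.
  by rewrite -(size_map val) (perm_size (dperm i)) size_iota.
have dcount i x : count_mem x (flatten (ds i)) = 1.
  rewrite count_uniq_mem // -(mem_map val_inj) (perm_mem (dperm i)) mem_iota /=.
  by rewrite ltn_ord.
have cuniq i c : c \in ds i -> uniq c.
  exact: flatten_uniq_mem (duniq i).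
pose m i (x y : 'I_v) := \sum_(c <- ds i) mult x y (closed_edges c).
have mE i x y : m i x y = \sum_(c <- cs i) mult (val x) (val y) (closed_edges c).
  rewrite -dsE big_map; apply: eq_bigr => c _.
  by rewrite closed_edges_map mult_map //; apply: val_inj.
have m1 x y : x != y -> \sum_i m i x y <= 1.
  by move=> xy; under eq_bigr do rewrite mE; apply: cmult; rewrite ?ltn_ord.
have mloop i x : m i x x = 0.
  apply: big1_seq => c /andP[_ ci]; apply: mult_closed_loop; last exact: cuniq ci.
  have : size c \in ms by rewrite -(dsz i) map_f.
  by move/(allP ms3); lia.
have mdeg i x : \sum_y m i x y = 2.
  rewrite exchange_big /= (eq_bigr (fun c => 2 * count_mem x c)) => [|c _].
    rewrite -big_distrr /= (_ : \sum_(c <- ds i) _ = 1) //.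
    by rewrite -(dcount i x) count_flatten sumnE big_map.
  rewrite -degree_closed -(degree_sum x (enum_uniq 'I_v)) ?big_enum //.
  by move=> e _; rewrite !mem_enum.
pose G i := \bigcup_(c <- ds i) cycle_edges c.
have mG i x y : x != y -> ([set x; y] \in G i) = (0 < m i x y).
  move=> xy; apply/bigcup_seqP/idP => [[c ci /imsetP[z zc]]|].
    move=> zE; rewrite /m (big_rem c) //= ltn_addr //.
    have zn : (z, next c z) \in closed_edges c.
      by rewrite closed_edges_next ?eqxx ?zc ?(cuniq i).
    have [[-> ->]|[-> ->]] : (x = z /\ y = next c z) \/ (x = next c z /\ y = z).
      have := set21 x y; rewrite zE => /set2P xE; have := set22 x y; rewrite zE => /set2P yE.
      case: xE yE xy => -> [->|->]; rewrite ?eqxx; by [left | right | ].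
    - by rewrite /mult ltn_addr // -has_count; apply/hasP; exists (z, next c z) => /=.
    - by rewrite /mult ltn_addl // -has_count; apply/hasP; exists (z, next c z) => /=.
  move=> m0; have /hasP[c ci] : has (fun c => 0 < mult x y (closed_edges c)) (ds i).
    rewrite -[has _ _]negbK -all_predC; apply/negP => /allP H; move: m0.
    by rewrite /m big1_seq // => c /andP[_ /H] /=; rewrite lt0n negbK => /eqP.
  have cmem a b : (a, b) \in closed_edges c -> [set a; b] \in cycle_edges c.
    rewrite closed_edges_next ?(cuniq i) // => /andP[ac /eqP ->]; exact: imset_f.
  rewrite /mult addn_gt0 -!has_count => /orP[] /hasP[e ec] /= /eqP eE; exists c => //.
    by apply: cmem; rewrite -eE.
  by rewrite setUC; apply: cmem; rewrite -eE.
pose M x := [set y | (y != x) && (\sum_i m i x y == 0)].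
have cardM x : #|M x| = mu.
  have : \sum_y \sum_i m i x y = 2 * N.
    rewrite exchange_big /= (eq_bigr (fun=> 2)) // sum_nat_const card_ord; lia.
  rewrite (bigD1 x) //= [X in X + _]big1 // add0n.
  have : \sum_(y | y != x) 1 = v.-1.
    by rewrite sum1_card cardC1 card_ord.
  have -> : #|M x| = \sum_(y | y != x) (\sum_i m i x y == 0).
    rewrite -sum1_card big_mkcond [RHS]big_mkcond; apply: eq_bigr => y _.
    by rewrite inE; case: (y != x) => //; case: eqP.
  have -> : \sum_(y | y != x) 1 =
      \sum_(y | y != x) \sum_i m i x y + \sum_(y | y != x) (\sum_i m i x y == 0).
    rewrite -big_split; apply: eq_bigr => y yx /=.
    by have := m1 x y; rewrite eq_sym => /(_ yx); case: (\sum_i _) => [|[]].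
  move=> + E1; rewrite E1; move: (\sum_(y | y != x) _) => k; lia.
have e2 (e : {set 'I_v}) : e \in complete_edges v -> exists x y, x != y /\ e = [set x; y].
  by rewrite inE => /cards2P.
have in2 x y : ([set x; y] \in complete_edges v) = (x != y).
  by rewrite inE cards2; case: (x != y).
pose E := \bigcup_i G i.
have GK i e : e \in G i -> e \in complete_edges v.
  case/bigcup_seqP=> [c ci /imsetP[x xc ->]]; rewrite in2.
  apply/negP => /eqP xn; have := mloop i x; rewrite /m (big_rem c) //= => /eqP.
  rewrite addn_eq0 => /andP[]; rewrite /mult addn_eq0 => /andP[/eqP/count_memPn/negP nxx _] _.
  by case: nxx; rewrite closed_edges_next ?(cuniq i) // xc -xn /=.
have EK : E \subset complete_edges v.
  by apply/bigcupsP => i _; apply/subsetP => e; apply: GK.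
have inE2 x y : x != y -> ([set x; y] \in E) = (y \notin M x).
  move=> xy; rewrite inE eq_sym xy /= -lt0n; apply/bigcupP/idP => [[i _]|].
    by rewrite mG // (bigD1 i) //= => ?; rewrite ltn_addr.
  rewrite lt0n sum_nat_eq0 negb_forall => /existsP[i]; rewrite /= -lt0n => mi.
  by exists i => //; rewrite mG.
exists E, [seq G i | i <- enum 'I_N]; split.
- rewrite /Kstar_edges -/v.
  have -> : odd v = ~~ mu by rewrite vE oddD /= oddM /=; case: (mu).
  case mu0 : mu => /=; last first.
    apply/eqP; rewrite eqEsubset EK; apply/subsetP => e /e2[x [y [xy ->]]].
    rewrite inE2 //; have /eqP := cardM x; rewrite mu0 cards_eq0 => /eqP ->; by rewrite inE.
  exists (complete_edges v :\: E); split; last by rewrite setDDr setDv set0U (setIidPr EK).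
  split; first exact: subsetDl.
  move=> x; rewrite -[RHS]/(nat_of_bool true) -mu0 -(cardM x).
  have inj : {in M x &, injective (fun y => [set x; y])}.
    move=> y z; rewrite !inE => /andP[yx _] /andP[zx _] /setP/(_ y).
    by rewrite !inE eqxx orbT (negPf yx) /= => /esym/eqP.
  rewrite -(card_in_imset inj); congr #|pred_of_set _|; apply/setP => e; rewrite inE.
  apply/andP/imsetP => [[]|[y yM ->]]; last first.
    have xy : x != y by move: yM; rewrite inE eq_sym => /andP[].
    by rewrite inE inE2 // yM in2 xy set21.
  rewrite inE => /andP[eE /e2[a [b [ab eab]]]]; rewrite eab in eE *.
  rewrite !inE => /orP[/eqP xa|/eqP xb].
    by exists b; rewrite -?xa // in ab eE *; move: eE; rewrite inE2 // negbK.
  exists a; last by rewrite xb setUC.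
  by move: eE; rewrite setUC inE2 1?eq_sym // negbK xb.
- move=> F /mapP[i _ ->]; exists (ds i); split => //.
- move=> i j; rewrite size_map size_enum_ord => iN jN ij.
  have nthG k (kN : k < N) : nth set0 [seq G i | i <- enum 'I_N] k = G (Ordinal kN).
    rewrite (nth_map (Ordinal kN)) ?size_enum_ord //; congr G.
    by apply: val_inj; rewrite /= nth_enum_ord.
  rewrite !nthG; apply/pred0P => e /=; apply/negP => /andP[ei ej].
  have [x [y [xy eE]]] := e2 _ (GK _ _ ei).
  move: ei ej (m1 x y xy); rewrite eE !mG // (bigD1 (Ordinal iN)) //= (bigD1 (Ordinal jN)) //=.
    by lia.
  by rewrite -val_eqE /= eq_sym.
by rewrite big_map big_enum.
Qed.

(** * Short cycles and a zigzag path with distinct differences *)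

Definition dist (e : nat * nat) := (e.1 - e.2) + (e.2 - e.1).

(** For [ds] running down from [n] to 1 this is the zigzag path of Walecki's decompositions. *)
Fixpoint zigzag (up : bool) (a : nat) (ds : seq nat) :=
  if ds is d :: ds' then a :: zigzag (~~ up) (if up then a + d else a - d) ds' else [:: a].

Lemma zigzag_head up a ds : exists s, zigzag up a ds = a :: s.
Proof. by case: ds => [|d ds] /=; eexists. Qed.

(** As the steps strictly decrease, the path stays inside the interval spanned by its latest step
    and never returns to an earlier vertex. The last hypothesis keeps a first downward step from
    being truncated at 0. *)
Lemma zigzagP up a ds :
  sorted gtn ds -> all (leq 1) ds -> (up || (head 0 ds <= a)) ->
  [/\ uniq (zigzag up a ds),
      forall x, x \in zigzag up a ds ->
        if up then a <= x <= a + head 0 ds else a - head 0 ds <= x <= a &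
      map dist (path_edges (zigzag up a ds)) = ds].
Proof.
elim: ds up a => [|d ds IHds] up a /=.
  by move=> _ _ _; split=> // x; rewrite inE => /eqP ->; case: up; lia.
move=> pd /andP[d0 ds0] da.
have hd : head 0 ds < d by case: ds pd {IHds ds0} => //= d' ds /andP[].
have [|//||uz zb ze] := IHds (~~ up) (if up then a + d else a - d).
- exact: path_sorted pd.
- by case: up da => /= da; lia.
split.
- rewrite uz andbT; apply/negP => /zb; case: (up) da => /=; lia.
- by move=> x; rewrite inE => /predU1P[->|/zb]; case: (up) da => /= da; lia.
have [s sE] := zigzag_head (~~ up) (if up then a + d else a - d) ds.
rewrite sE /= in ze *; rewrite ze; congr (_ :: _).
by rewrite /dist /=; case: (up) da => /= da; lia.
Qed.

(** * Greedy choice of vertices with new differences *)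

Lemma fresh_in_window A W (F : seq nat) : size F < W -> exists2 x, A <= x < A + W & x \notin F.
Proof.
move=> FW; have /hasP[x] : has (fun x => x \notin F) (iota A W).
  rewrite -[has _ _]negbK -all_predC; apply/negP => /allP sub.
  have := uniq_leq_size (iota_uniq A W) (s2 := F); rewrite size_iota leqNgt FW => /(_ _)/negP; case=> //.
  by move=> x /sub /=; rewrite negbK.
by rewrite mem_iota; exists x.
Qed.

Section Greedy.
Variables A W : nat.
Let in_window x := A <= x < A + W.

(** Contains every vertex whose difference with [a] is in [D]; truncation of [a - d] can only add
    the vertex 0. *)
Definition ball (D : seq nat) a := [seq a + d | d <- D] ++ [seq a - d | d <- D].

Lemma size_ball D a : size (ball D a) = 2 * size D.
Proof. by rewrite size_cat !size_map mul2n addnn. Qed.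

Lemma dist_ball D a x : x \notin ball D a -> (dist (x, a) \notin D) && (dist (a, x) \notin D).
Proof.
rewrite mem_cat negb_or => /andP[/mapP n1 /mapP n2].
rewrite /dist /=; apply/andP; split; apply/negP => dD.
  by case: (leqP a x) => ax; [apply: n1 | apply: n2]; eexists; eauto; lia.
by case: (leqP a x) => ax; [apply: n1 | apply: n2]; eexists; eauto; lia.
Qed.

(** The next vertex avoids all used vertices and, for each used difference, two places around the
    current head. Each step adds one vertex and one difference, whence [3 * k]. *)
Lemma greedy_path (uv ud : seq nat) k : uniq uv -> uniq ud -> size uv + 2 * size ud + 3 * k < W ->
  exists s, [/\ size s = k.+1, all in_window s, uniq (s ++ uv) &
                uniq (map dist (path_edges s) ++ ud)].
Proof.
move=> uuv uud; elim: k => [|k IHk] kW.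
  have [|x xW xF] := @fresh_in_window A W uv; first by lia.
  by exists [:: x]; split; rewrite //= ?andbT ?xF.
have [|s [ss sW us ud_s]] := IHk; first by lia.
case: s ss sW us ud_s => [//|a s] [ss] sW us ud_s.
set D := map dist _ ++ ud in ud_s.
have szD : size D = k + size ud by rewrite /D size_cat size_map size_path_edges /= ss.
have [|x xW] := @fresh_in_window A W (((a :: s) ++ uv) ++ ball D a).
  by rewrite size_cat size_ball szD size_cat /= ss; lia.
rewrite mem_cat negb_or => /andP[xs /dist_ball/andP[xa _]].
exists [:: x, a & s]; split.
- by rewrite /= ss.
- by rewrite /= in sW *; rewrite sW andbT.
- by rewrite cat_cons cons_uniq xs us.
- by rewrite path_edges_cons map_cons cat_cons cons_uniq xa.
Qed.

(** A path on [l - 1] vertices is closed by a vertex adjacent to both its ends, so each used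
    difference now forbids four places. *)
Lemma greedy_cycle (uv ud : seq nat) l : uniq uv -> uniq ud -> 2 < l ->
  size uv + 4 * size ud + 5 * l <= W ->
  exists c, [/\ size c = l, all in_window c, uniq (c ++ uv) &
                uniq (map dist (closed_edges c) ++ ud)].
Proof.
move=> uuv uud l2 lW.
have [|s [ss sW us ud_s]] := @greedy_path uv ud l.-2 uuv uud; first by lia.
case: s ss sW us ud_s => [//|a [|b s]] [ss] sW us ud_s; first by move: ss => /=; lia.
pose e := last b s.
set D := map dist _ ++ ud in ud_s.
have szD : size D = l.-2 + size ud by rewrite /D size_cat size_map size_path_edges /= -ss.
(* The two closing differences must also differ from each other; as [a] and [e] are distinct, they
   agree only at the midpoint of [a] and [e]. *)
have [|x xW] := @fresh_in_window A W
    (((a + e)./2 :: [:: a, b & s] ++ uv) ++ (ball D a ++ ball D e)).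
  rewrite size_cat [size (_ ++ ball _ _)]size_cat !size_ball szD /= size_cat; lia.
rewrite mem_cat negb_or => /andP[]; rewrite inE negb_or => /andP[xm xs].
rewrite mem_cat negb_or => /andP[/dist_ball/andP[xa _] /dist_ball/andP[_ xe]].
exists [:: x, a, b & s]; split.
- by rewrite /= ss; lia.
- by apply/andP; split.
- by rewrite cat_cons cons_uniq xs.
have -> : closed_edges [:: x, a, b & s] = (x, a) :: rcons (path_edges [:: a, b & s]) (e, x).
  by rewrite /= -!cats1 pairmap_cat.
rewrite map_cons map_rcons cat_cons cat_rcons.
rewrite (perm_uniq (_ : perm_eq _ [:: dist (x, a), dist (e, x) & D])); last first.
  by rewrite perm_cons -[_ :: ud]cat1s perm_catCA.
rewrite cons_uniq cons_uniq in_cons negb_or xa xe ud_s !andbT.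
have ae : a != e.
  move: us; rewrite cat_uniq => /and3P[/andP[an _] _ _].
  by apply: contraNneq an => ->; apply: mem_last.
apply: contraNneq xm; rewrite /dist /= => dE; apply/eqP.
by move/eqP: ae; lia.
Qed.

(** A cycle has as many edges as vertices, so every vertex placed earlier accounts for one used
    vertex and one used difference: [1 + 4] forbidden places. *)
Lemma greedy_cycles ls : all (leq 3) ls -> 5 * sumn ls <= W ->
  exists bc, [/\ map size bc = ls, all in_window (flatten bc), uniq (flatten bc) &
                 uniq (map dist (flatten (map (@closed_edges nat) bc)))].
Proof.
elim: ls => [|l ls IHls] /=; first by exists [::].
case/andP=> l3 /IHls{}IHls lW; have [|bc [bs bW ub ue]] := IHls; first by lia.
have [|c [cs cW uc uce]] := @greedy_cycle (flatten bc) _ l ub ue l3.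
  rewrite size_map !size_flatten /shape bs -map_comp.
  by rewrite (eq_map (@size_closed_edges _)) bs; lia.
exists (c :: bc); split=> //=; first by rewrite cs bs.
  by rewrite all_cat cW.
by rewrite map_cat.
Qed.

End Greedy.

(** * Padding with trivial paths and counting ends *)

Lemma pad_paths r t (cs P : seq (seq nat)) :
  uniq (flatten cs ++ flatten P) -> all (fun x => x < r) (flatten cs ++ flatten P) ->
  size P + r <= t + size (flatten cs ++ flatten P) ->
  exists ps, [/\ size ps = t, perm_eq (flatten cs ++ flatten ps) (iota 0 r) &
    forall x y, \sum_(p <- ps) mult x y (path_edges p) = \sum_(p <- P) mult x y (path_edges p)].
Proof.
set s := flatten cs ++ flatten P => us sr st.
pose R : seq nat := [seq x : nat <- iota 0 r | x \notin s].
have perm : perm_eq (s ++ R) (iota 0 r).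
  apply: uniq_perm; rewrite ?iota_uniq //.
    rewrite cat_uniq us filter_uniq ?iota_uniq // andbT; apply/hasPn => x.
    by rewrite mem_filter => /andP[].
  move=> x; rewrite mem_cat mem_filter mem_iota /=.
  by case: (boolP (x \in s)) => //= /(allP sr) ->.
have sz : size s + size R = r by have := perm_size perm; rewrite size_cat size_iota.
exists (P ++ [seq [:: x] | x <- R] ++ nseq (t - (size P + size R)) [::]); split.
- by rewrite !size_cat size_map size_nseq; lia.
- rewrite !flatten_cat flatten_seq1 (_ : flatten (nseq _ [::]) = [::]) ?cats0 ?catA //.
  by elim: (_ - _).
move=> x y; rewrite !big_cat /= big_map [\sum_(i <- R) _]big1 //.
rewrite [\sum_(i <- nseq _ _) _]big1_seq ?addn0 // => p.
by rewrite mem_nseq => /andP[_ /andP[_ /eqP ->]].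
Qed.

(** Degree plus ends is 2 at every vertex in each colour. Over [N] colours this gives [2 * N], of
    which the complete graph takes [r.-1]. *)
Lemma complete_ends N (cs ps : 'I_N -> seq (seq nat)) r :
  (forall i, perm_eq (flatten (cs i) ++ flatten (ps i)) (iota 0 r)) ->
  (forall i c, c \in cs i -> 1 < size c) ->
  (forall x y, x < r -> y < r -> x != y ->
    \sum_i (\sum_(c <- cs i) mult x y (closed_edges c)
            + \sum_(p <- ps i) mult x y (path_edges p)) = 1) ->
  forall x, x < r -> \sum_i \sum_(p <- ps i) ends x p + r.-1 = 2 * N.
Proof.
move=> pp c1 m1 x xr.
have mem i c : c \in cs i \/ c \in ps i -> forall z, z \in c -> z \in iota 0 r.
  move=> cI z zc; rewrite -(perm_mem (pp i)) mem_cat; apply/orP.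
  by case: cI => cI; [left | right]; apply/flattenP; exists c.
have un i c : c \in cs i \/ c \in ps i -> uniq c.
  have := iota_uniq 0 r; rewrite -(perm_uniq (pp i)) cat_uniq => /and3P[uc _ up].
  by case; apply: flatten_uniq_mem.
have deg i : \sum_(y <- iota 0 r) (\sum_(c <- cs i) mult x y (closed_edges c)
            + \sum_(p <- ps i) mult x y (path_edges p)) + \sum_(p <- ps i) ends x p = 2.
  rewrite big_split /= exchange_big /= [X in _ + X + _]exchange_big /=.
  rewrite (eq_big_seq (fun c => 2 * count_mem x c)) => [|c ci]; last first.
    rewrite degree_sum ?iota_uniq ?degree_closed // => e /closed_edges_mem/andP[e1 e2].
    by rewrite !(mem i c) //; left.
  rewrite [X in _ + X + _](eq_big_seq (fun p => degree x (path_edges p))) => [|p pi]; last first.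
    rewrite degree_sum ?iota_uniq // => e /path_edges_mem/andP[e1 e2].
    by rewrite !(mem i p) //; right.
  rewrite -addnA -big_split /=; under [X in _ + X]eq_bigr do rewrite degree_path.
  rewrite -!big_distrr -mulnDr /=.
  have := permP (pp i) (pred1 x); rewrite count_cat !count_flatten !sumnE !big_map => ->.
  by rewrite count_uniq_mem ?iota_uniq // mem_iota xr.
rewrite [RHS](_ : _ = \sum_(i < N) 2); last by rewrite sum_nat_const card_ord mulnC.
rewrite -[RHS](eq_bigr _ (fun i _ => deg i)) big_split /= exchange_big /= addnC.
congr (_ + _).
rewrite (bigD1_seq x) ?iota_uniq ?mem_iota //= big1 => [|i _]; last first.
  rewrite !big1_seq // => [p|c] /andP[_ pi].
    by apply: mult_path_loop; apply: (un i); right.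
  by apply: mult_closed_loop; [apply: c1 pi | apply: (un i); left].
rewrite add0n big_seq_cond (eq_bigr (fun=> 1)) => [|y /andP[]]; last first.
  by rewrite mem_iota eq_sym => yr yx; apply: m1.
rewrite -big_seq_cond sum1_count.
have := count_predC (pred1 x) (iota 0 r).
rewrite count_uniq_mem ?iota_uniq // mem_iota xr size_iota /= => rE.
by rewrite -[in LHS]rE add1n.
Qed.

(** * Translates *)

Lemma sum_ord_unique N (F : 'I_N -> nat) j :
  j < N -> (forall i : 'I_N, F i = (nat_of_ord i == j)) -> \sum_i F i = 1.
Proof.
move=> jN FE; rewrite (bigD1 (Ordinal jN)) //= FE eqxx big1 // => i ij.
by rewrite FE; case: eqP => // E; case/eqP: ij; apply: val_inj.
Qed.

Definition translate N i a := if a + i < N then a + i else a + i - N.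

Lemma translate_lt N i a : i < N -> a < N -> translate N i a < N.
Proof. by rewrite /translate => iN aN; case: (ltnP (a + i)); lia. Qed.

Lemma translate_inj N i a b : i < N -> a < N -> b < N ->
  translate N i a = translate N i b -> a = b.
Proof.
by rewrite /translate => iN aN bN; case: (ltnP (a + i)) => ?; case: ltnP => ?; lia.
Qed.

Lemma translateK N i a x : i < N -> a < N -> x < N ->
  (translate N i a == x) = (i == if a <= x then x - a else x + N - a).
Proof. by rewrite /translate => iN aN xN; case: ltnP => ?; case: leqP => ?; lia. Qed.

Lemma translate_unique N a x : a < N -> x < N ->
  \sum_(i < N) (translate N i a == x) = 1.
Proof.
move=> aN xN; apply: (@sum_ord_unique _ _ (if a <= x then x - a else x + N - a)).
  by case: ifP; lia.
by move=> i; rewrite translateK.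
Qed.

Lemma translateD N i a d : i < N -> a + d < N ->
  translate N i (a + d) = translate N d (translate N i a).
Proof. by rewrite /translate => iN adN; case: (ltnP (a + d + i)) => ?;
  case: (ltnP (a + i)) => ?; case: ltnP => ?; lia. Qed.

Lemma mult1_swap (x y a b : nat) : mult x y [:: (b, a)] = mult x y [:: (a, b)].
Proof. by rewrite !mult1E addnC andbC [(b == x) && _]andbC. Qed.

(* The difference [N/2] of an even [N] is its own opposite, so that only half of its
   translates are kept. *)
Definition kept N i d := [|| odd N, d != N./2 | i < N./2].

(** For [d] below [N / 2] exactly one translate falls on the pair. For [2 * d = N] two do, with
    shifts half a turn apart, and [kept] retains the one with the smaller shift. *)
Lemma translates_cover1 N a d x (y := translate N d x) : x < N -> a + d < N -> 0 < d <= N./2 ->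
  \sum_(i < N) kept N i d * mult x y [:: (translate N i a, translate N i (a + d))] = 1.
Proof.
move=> xN adN dh; have aN : a < N by lia.
have yN : y < N by apply: translate_lt; lia.
have yyE : (translate N d y == x) = (d + d == N).
  by rewrite /y /translate; case: (ltnP (x + d)) => ?; case: ltnP => ?; lia.
have termE (i : 'I_N) : mult x y [:: (translate N i a, translate N i (a + d))] =
    (translate N i a == x) + (d + d == N) && (translate N i a == y).
  rewrite mult1E translateD //; congr (nat_of_bool _ + nat_of_bool _).
    by case: eqVneq => [->|//]; rewrite eqxx.
  by rewrite andbC; case: (eqVneq _ y) => [->|_]; rewrite ?andbF // yyE.
case: (eqVneq (d + d) N) termE => [dN|dN] termE.
  have par : ~~ odd N by rewrite -dN oddD addbb.
  have dE : d = N./2 by rewrite -dN addnn doubleK.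
  pose ox := if a <= x then x - a else x + N - a.
  pose oy := if a <= y then y - a else y + N - a.
  have oyE : (oy = ox + d /\ ox < d) \/ (ox = oy + d /\ oy < d).
    have : y = x + d \/ y + N = x + d by rewrite /y /translate; case: (ltnP (x + d)); lia.
    by rewrite /oy /ox; case: (leqP a x) => ?; case: (leqP a y) => ?; lia.
  apply: (@sum_ord_unique _ _ (minn ox oy)); first by lia.
  move=> i; rewrite termE /= !translateK -/ox -/oy //.
  rewrite /kept (negPf par) -dE eqxx /=; have := ltn_ord i.
  move: (nat_of_ord i) => j jN; case: (ltnP j d) => ?; rewrite ?mul0n ?mul1n;
  by case: (j =P ox) => ?; case: (j =P oy) => ?; case: (j =P minn ox oy) => ?; lia.
apply: etrans (translate_unique aN xN); apply: eq_bigr => i _; rewrite termE addn0 /kept.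
by rewrite (_ : odd N || _ = true) ?mul1n //; lia.
Qed.

(** The minimum on the right is the cyclic distance of [x] and [y]: an edge covers, by its
    translates, exactly the pairs at its own distance. *)
Lemma translates_cover N x y e :
  x < N -> y < N -> x != y -> e.1 < N -> e.2 < N -> 0 < dist e <= N./2 ->
  \sum_(i < N) kept N i (dist e) * mult x y [:: (translate N i e.1, translate N i e.2)]
    = (dist e == minn (dist (x, y)) (N - dist (x, y))).
Proof.
move=> xN yN xy; have -> : e = (e.1, e.2) by case: e.
move: e.1 e.2 => {e} a b /=.
wlog ab : a b / a <= b => [IH aN bN|].
  case: (leqP a b) => [|/ltnW] ab; first exact: IH.
  under eq_bigr do rewrite mult1_swap.
  by have -> : dist (a, b) = dist (b, a) by [rewrite /dist addnC]; apply: IH.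
have -> : dist (a, b) = b - a by rewrite /dist /=; lia.
have -> : b = a + (b - a) by lia.
rewrite addKn; move: (b - a) => d _ {ab} ad dh.
case: eqVneq => dE.
  have [yE|xE] : y = translate N d x \/ x = translate N d y.
    by move: dE; rewrite /dist /translate /=; do 2!case: ltnP => ?; lia.
  - by rewrite yE translates_cover1.
  - under eq_bigr do rewrite mult_sym.
    by rewrite xE translates_cover1.
apply: big1 => i _; rewrite translateD // mult1E; apply/eqP.
rewrite muln_eq0; apply/orP; right; rewrite addn_eq0 !eqb0.
move: (translate N i a) => u; apply/andP; split; apply/negP => /andP[/eqP -> /eqP].
  by move: dE; rewrite /dist /translate /=; case: ltnP => ?; lia.
by move: dE; rewrite /dist /translate /=; case: ltnP => ?; lia.
Qed.

(** The window of the cycles starts above [h] and is too short for a difference [h]. So [h] is left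
    to the zigzag, which opens with the edge from 0 to [h] and stays in [0 .. h], away from the
    cycles. *)
Lemma difference_starter N ls :
  all (leq 3) ls -> 5 * sumn ls + 2 <= N./2 ->
  exists (bc : seq (seq nat)) (zz : seq nat),
  let BE := flatten (map (@closed_edges nat) bc) ++ path_edges (0 :: N./2 :: zz) in
  [/\ map size bc = ls, all (fun x => x < N) (flatten bc ++ 0 :: N./2 :: zz),
      uniq (flatten bc ++ 0 :: N./2 :: zz) & perm_eq (map dist BE) (iota 1 N./2)].
Proof.
set h := N./2 => ls3 hls.
have Nh : h + h <= N <= h + h + 1 by rewrite /h; lia.
have [|bc [bs bW ub ue]] := @greedy_cycles h.+1 (N - h.+1) ls ls3; first by lia.
pose D : seq nat := map dist (flatten (map (@closed_edges nat) bc)).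
have bcW x : x \in flatten bc -> h < x < N by move=> /(allP bW); lia.
have DP d : d \in D -> 0 < d < h.
  case/mapP=> -[a b] /flatten_mapP[c cb ab] ->.
  have sub x : x \in c -> h < x < N by move=> xc; apply: bcW; apply/flattenP; exists c.
  have /andP[/sub ah /sub bh] := closed_edges_mem ab.
  suff ne : a <> b by move: ah bh; rewrite /dist /=; lia.
  move=> abE; rewrite -{}abE /= in ab.
  have c1 : 1 < size c by have := allP ls3 (size c); rewrite -bs map_f // => /(_ isT); lia.
  have := mult_closed_loop a c1 (flatten_uniq_mem ub cb).
  by move/eqP; rewrite /mult addn_eq0 => /andP[/eqP/count_memPn]; rewrite ab.
have hD : h \notin D by apply/negP => /DP; lia.
pose ds' := [seq d : nat <- rev (iota 1 h.-1) | d \notin D].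
pose ds := h :: ds'.
have dsE : ds = [seq d : nat <- rev (iota 1 h) | d \notin D].
  have -> : iota 1 h = iota 1 h.-1 ++ [:: h].
    have -> : h = h.-1 + 1 by lia.
    by rewrite iotaD addn1 /= add1n.
  by rewrite rev_cat /= hD.
have sds : sorted gtn ds.
  rewrite dsE; apply: sorted_filter; first by move=> a b c /= ab bc'; lia.
  by rewrite rev_sorted; apply: iota_ltn_sorted.
have ds0 : all (leq 1) ds.
  by apply/allP => d; rewrite dsE mem_filter mem_rev mem_iota; lia.
have [uz zb ze] := @zigzagP true 0 ds sds ds0 isT.
have [zz zzE] := zigzag_head false h ds'.
have zE : zigzag true 0 ds = 0 :: h :: zz by rewrite /= zzE.
rewrite zE in uz zb ze.
exists bc, zz; split=> //.
- rewrite all_cat; apply/andP; split; apply/allP => x; first by move/bcW; lia.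
  by move/zb => /=; lia.
- by rewrite cat_uniq ub uz andbT; apply/hasPn => x /zb /= xh; apply/negP => /bcW; lia.
rewrite map_cat ze -/D; apply: uniq_perm; rewrite ?iota_uniq //.
  rewrite cat_uniq ue dsE filter_uniq ?rev_uniq ?iota_uniq // andbT; apply/hasPn => d.
  by rewrite mem_filter => /andP[].
move=> d; rewrite mem_cat dsE mem_filter mem_rev mem_iota.
by case: (boolP (d \in D)) => //= /DP; lia.
Qed.

(** * The initial stage on [N + 1] vertices *)

Section BaseStage.
Variables (N : nat) (bc : seq (seq nat)) (zz : seq nat).
Let h := N./2.
Let zt := 0 :: h :: zz.
Let tr (i : 'I_N) := translate N i.
Let BE := flatten (map (@closed_edges nat) bc) ++ path_edges zt.
Hypothesis bcN : all (fun x => x < N) (flatten bc ++ zt).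
Hypothesis ubc : uniq (flatten bc ++ zt).
Hypothesis distBE : perm_eq (map dist BE) (iota 1 h).
Hypothesis bc0 : 2 < size (flatten bc).
Hypothesis bc2 : forall c, c \in bc -> 1 < size c.

(* The number [N] is the vertex outside [Z_N]. *)
Let base_paths (i : 'I_N) := if kept N i h then [:: rcons (map (tr i) zt) N]
  else [:: [:: tr i 0]; rcons (map (tr i) (h :: zz)) N].
Let base_cycles (i : 'I_N) := map (map (tr i)) bc.

Lemma base_flatten i :
  flatten (base_cycles i) ++ flatten (base_paths i) = rcons (map (tr i) (flatten bc ++ zt)) N.
Proof.
rewrite -map_flatten map_cat rcons_cat; congr (_ ++ _).
by rewrite /base_paths; case: ifP => _ /=; rewrite cats0.
Qed.

Lemma BE_lt e : e \in BE -> [/\ e.1 < N, e.2 < N & 0 < dist e <= h].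
Proof.
move=> eB; have : dist e \in iota 1 h by rewrite -(perm_mem distBE) map_f.
rewrite mem_iota add1n ltnS => dh.
suff /andP[/(allP bcN) -> /(allP bcN) ->] :
  (e.1 \in flatten bc ++ zt) && (e.2 \in flatten bc ++ zt) by [].
move: eB; rewrite mem_cat !mem_cat => /orP[/flatten_mapP[c cb /closed_edges_mem/andP[e1 e2]]|].
  by apply/andP; split; apply/orP; left; apply/flattenP; exists c.
by move/path_edges_mem/andP=> [-> ->]; rewrite !orbT.
Qed.

(** Differences in [BE] are pairwise distinct, so the opening edge of the zigzag is the only one of
    difference [h]. It alone can fail to be kept, and then its first vertex is left as a separate
    path. *)
Lemma base_mult i x y :
  \sum_(c <- base_cycles i) mult x y (closed_edges c)
  + \sum_(p <- base_paths i) mult x y (path_edges p) =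
  \sum_(e <- BE) kept N i (dist e) * mult x y [:: (tr i e.1, tr i e.2)]
  + (N == y) && (tr i (last 0 zt) == x) + (N == x) && (tr i (last 0 zt) == y).
Proof.
have d0h : dist (0, h) = h by rewrite /dist /=; lia.
have dlt e : e \in flatten (map (@closed_edges nat) bc) ++ path_edges (h :: zz) -> kept N i (dist e).
  have : perm_eq BE ((0, h) :: flatten (map (@closed_edges nat) bc) ++ path_edges (h :: zz)).
    by rewrite /BE /= -[_ :: pairmap _ _ _]cat1s perm_catCA.
  move=> perm eB; rewrite /kept; apply/orP; right; apply/orP; left; apply/eqP => dE.
  have hin : h \in map dist (flatten (map (@closed_edges nat) bc) ++ path_edges (h :: zz)).
    by apply/mapP; exists e.
  have := iota_uniq 1 h; rewrite -(perm_uniq distBE) (perm_uniq (perm_map dist perm)).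
  by rewrite map_cons cons_uniq d0h hin.
have lastE (s : seq nat) a : ohead (rev (a :: s)) = Some (last a s).
  by rewrite lastI rev_rcons.
have multE l : (forall e, e \in l -> kept N i (dist e)) ->
   mult x y [seq (tr i e.1, tr i e.2) | e <- l] =
   \sum_(e <- l) kept N i (dist e) * mult x y [:: (tr i e.1, tr i e.2)].
  by move=> lk; rewrite mult_sum big_map; apply: eq_big_seq => e /lk ->; rewrite mul1n.
rewrite /BE; set PZ := path_edges zt; rewrite big_cat /= -[RHS]addnA -[RHS]addnA; congr (_ + _).
  rewrite big_map big_flatten big_map; apply: eq_big_seq => c cb; rewrite closed_edges_map.
  apply: multE => e ec; apply: dlt; rewrite mem_cat; apply/orP; left.
  by apply/flatten_mapP; exists c.
have pathE s a : (forall e, e \in path_edges (a :: s) -> kept N i (dist e)) ->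
    mult x y (path_edges (rcons (map (tr i) (a :: s)) N)) =
    \sum_(e <- path_edges (a :: s)) kept N i (dist e) * mult x y [:: (tr i e.1, tr i e.2)]
    + ((N == y) && (tr i (last a s) == x) + (N == x) && (tr i (last a s) == y)).
  move=> sk; rewrite mult_path_rcons path_edges_map multE // -addnA.
  by rewrite map_cons lastE last_map !(inj_eq Some_inj).
have kz e : e \in path_edges (h :: zz) -> kept N i (dist e).
  by move=> ez; apply: dlt; rewrite mem_cat ez orbT.
rewrite /PZ /base_paths; case: ifP => kh.
  rewrite big_seq1 pathE // => e; rewrite path_edges_cons inE => /predU1P[->|]; last exact: kz.
  by rewrite d0h.
rewrite big_cons big_seq1 add0n pathE // [path_edges zt]path_edges_cons big_cons d0h kh.
by rewrite mul0n add0n.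
Qed.

(** Inside [Z_N] each cyclic distance occurs exactly once in [BE]. For edges to the vertex [N], the
    translates of the last zigzag vertex run once through [Z_N]. *)
Lemma base_mult_sum x y : x < N.+1 -> y < N.+1 -> x != y ->
  \sum_i (\sum_(c <- base_cycles i) mult x y (closed_edges c)
    + \sum_(p <- base_paths i) mult x y (path_edges p)) = 1.
Proof.
have trN (i : 'I_N) a : a < N -> tr i a < N by apply: translate_lt.
have lN : last 0 zt < N.
  by apply: (allP bcN); rewrite mem_cat; apply/orP; right; apply: (mem_last 0 (h :: zz)).
wlog xy : x y / x < y => [IH xN yN|xN yN _].
  rewrite neq_ltn => /orP[] xy; first by apply: IH; rewrite ?(ltn_eqF xy).
  under eq_bigr do (under eq_bigr do rewrite mult_sym;
    under [X in _ + X]eq_bigr do rewrite mult_sym).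
  by apply: IH; rewrite ?(ltn_eqF xy).
have xN' : x < N by lia.
under eq_bigr do rewrite base_mult (gtn_eqF xN') addn0.
rewrite big_split /= exchange_big /=.
move: yN; rewrite ltnS leq_eqVlt => /predU1P[->|yN].
  rewrite big1_seq => [|e /andP[_ /BE_lt[e1 e2 _]]]; last first.
    by apply: big1 => i _; rewrite mult1E !(ltn_eqF (trN i _ _)) // !andbF muln0.
  by under eq_bigr do rewrite eqxx /=; rewrite translate_unique.
rewrite [X in _ + X]big1 ?addn0 => [|i _]; last by rewrite (gtn_eqF yN).
pose d := minn (dist (x, y)) (N - dist (x, y)).
rewrite (eq_big_seq (fun e => (dist e == d) : nat)) => [|e /BE_lt[e1 e2 de]]; last first.
  by apply: translates_cover => //; rewrite (ltn_eqF xy).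
transitivity (count_mem d (map dist BE)).
  by rewrite count_map -sum1_count [RHS]big_mkcond; apply: eq_bigr => e _ /=; case: eqP.
rewrite (permP distBE) count_uniq_mem ?iota_uniq // mem_iota /d /dist /= /h.
by rewrite (_ : _ && _ = true) //; lia.
Qed.

(** For [mu = 1] no vertex is matched yet, so [U] consists of all [N.+1] vertices, which is the
    required size [N + mu]. *)
Lemma base_stage (mu : bool) : exists ps U, @stage N mu base_cycles N.+1 (N + mu) ps U.
Proof.
have /fin_all_exists[ps psP] (i : 'I_N) : exists ps, [/\ size ps = N + mu,
    perm_eq (flatten (base_cycles i) ++ flatten ps) (iota 0 N.+1) &
    forall x y, \sum_(p <- ps) mult x y (path_edges p) = \sum_(p <- base_paths i) mult x y (path_edges p)].
  apply: pad_paths; rewrite base_flatten.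
  - rewrite rcons_uniq map_inj_in_uniq ?ubc ?andbT; last first.
      by move=> a b /(allP bcN) aN /(allP bcN) bN; apply: translate_inj.
    apply/mapP => -[a /(allP bcN) aN NE].
    by have := translate_lt (ltn_ord i) aN; rewrite -/(tr i a) -NE ltnn.
  - rewrite all_rcons ltnSn; apply/allP => _ /mapP[a /(allP bcN) aN ->].
    by apply: leqW; apply: translate_lt.
  - rewrite size_rcons size_map size_cat /= /base_paths; case: ifP => _ /=; lia.
exists ps, (if mu then iota 0 N.+1 else [::]).
have total x y : x < N.+1 -> y < N.+1 -> x != y ->
    \sum_i (\sum_(c <- base_cycles i) mult x y (closed_edges c)
            + \sum_(p <- ps i) mult x y (path_edges p)) = 1.
  move=> xN yN xy; rewrite -(base_mult_sum xN yN xy); apply: eq_bigr => i _.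
  by have [_ _ ->] := psP i.
split.
- by move=> i; have [] := psP i.
- by move=> i; have [] := psP i.
- by move=> x y xN yN xy; rewrite total.
- case: (mu); split; rewrite ?iota_uniq ?size_iota //; first by lia.
  by move=> x; rewrite mem_iota.
move=> x xN.
have : \sum_i \sum_(p <- ps i) ends x p + N.+1.-1 = 2 * N.
  apply: (complete_ends _ _ total xN); first by move=> i; have [] := psP i.
  by move=> i c /mapP[c' cb ->]; rewrite size_map bc2.
have -> : (x \in if mu then iota 0 N.+1 else [::]) = mu by case: (mu); rewrite // mem_iota.
by move: (\sum_i _) => n; lia.
Qed.

End BaseStage.

(** * A linear bound, and the stated one *)

Theorem OP_large_cycle (ls : seq nat) y :
  0 < size ls -> all (leq 3) ls -> 20 * sumn ls + 20 <= y -> OP_solvable (y :: ls).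
Proof.
move=> ls0 ls3 yls; pose v := y + sumn ls; pose N := v.-1./2; pose mu := odd v.-1.
have vE : v = (2 * N).+1 + mu by rewrite /N /mu; have := odd_double_half v.-1; lia.
have b3 : 2 < sumn ls by case: ls ls0 ls3 {yls v N mu vE} => //= l ls _ /andP[l3 _]; lia.
(* [N./2] is close to a quarter of [y + sumn ls], hence at least [5 * sumn ls + 2]: this is the
   origin of the factor 20. *)
have [|bc [zz [bs bN ub dBE]]] := @difference_starter N ls ls3.
  by move: vE; rewrite /v; case: (mu) => /=; lia.
have bc3 c : c \in bc -> 2 < size c.
  by move=> cb; apply: (allP ls3); rewrite -bs map_f.
have [|c /bc3/ltnW //|ps [U st]] := base_stage bN ub dBE _ _ mu.
  by rewrite size_flatten /shape bs.
have NE : N = N.-1.+1 by move: vE; rewrite /v; case: (mu) => /=; lia.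
have [ps' [U' st']] : exists ps' U',
    @stage N mu (fun i => map (map (translate N i)) bc) (2 * N + mu) 1 ps' U'.
  have tE : N + mu = (N.-1 + mu).+1 by lia.
  by rewrite tE in st; apply: stage_embed st; lia.
have [i|||cs [csz cperm cmult]] := @stage_close N mu _ _ ps' U' ls y _ _ _ st'.
- by rewrite -bs -map_comp; apply: eq_map => c /=; rewrite size_map.
- by move: vE; rewrite /v; lia.
- by lia.
have vE' : (2 * N + mu).+1 = sumn (y :: ls) by rewrite /= -/v vE.
apply: (@OP_of_cycles N mu (y :: ls) cs); rewrite -?vE' //.
by rewrite /= ls3 andbT; lia.
Qed.

Lemma sumn_leq_max (s : seq nat) : sumn s <= size s * \max_(l <- s) l.
Proof.
elim: s => [//|l s IHs] /=; rewrite big_cons mulSn.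
by rewrite leq_add ?leq_maxl // (leq_trans IHs) // leq_mul2l leq_maxr orbT.
Qed.

Lemma leq_mul_exp7 k : 7 * k <= 7 ^ k.
Proof. by case: k => // k; rewrite expnS leq_mul2l /= ltn_expl. Qed.

(* b = sumn ls, b0 = 2|L0|(max L0 + 3), and 28*b1 = 4 * 7^|L1| * (2 max L1 + 1)
   (exact, also when L1 is empty, where b1 = 7^(-1)). *)
Theorem theorem1p1 (ls : seq nat) :
  0 < size ls ->
  all (fun l => 3 <= l) ls ->
  forall y : nat,
    3 * sumn ls
    + 24 * (2 * size [seq l <- ls | ~~ odd l]
              * (\max_(l <- [seq l <- ls | ~~ odd l]) l + 3))
    + 4 * (7 ^ size [seq l <- ls | odd l]
              * (2 * \max_(l <- [seq l <- ls | odd l]) l + 1))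
    + 119 <= y ->
    OP_solvable (y :: ls).
Proof.
move=> ls0 ls3 y yls; apply: OP_large_cycle => //; apply: leq_trans yls.
have -> : sumn ls = sumn [seq l <- ls | odd l] + sumn [seq l <- ls | ~~ odd l].
  by elim: ls {ls0 ls3} => //= l ls ->; case: (odd l) => /=; lia.
(* The even term is at least 48 times the sum of the even lengths. By [7 * k <= 7 ^ k] the odd term
   is at least 56 times the sum of the odd ones. Both factors exceed 20. *)
have := sumn_leq_max [seq l <- ls | odd l]; have := sumn_leq_max [seq l <- ls | ~~ odd l].
have := leq_mul_exp7 (size [seq l <- ls | odd l]).
move: (size _) (size _) (\max_(l <- _) l) (\max_(l <- _) l) (sumn _) (sumn _) => k1.
move: (7 ^ k1) => e; nia.
Qed.
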